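(* Let $\sigma_0\in S_n$ be the longest permutation, $\sigma_0(m)=n+1-m$. For all $J,K\in\mathcal I_\lambda$, $$\sum_{I\in\mathcal I_\lambda}h^{p(K)}P(z_I)\,\frac{\widetilde W_{\mathrm{id},J}(z_I,z,h)\,\widetilde W_{\sigma_0,K}(z_I^{-1},z^{-1},h^{-1})}{R(z_I)\,Q(z_I,h)}=\delta_{J,K},$$ where $P(z_I)=\prod_{k<l}\prod_{a\in I_k}\prod_{b\in I_l}(-z_b/z_a)$, $R(z_I)=\prod_{k<l}\prod_{a\in I_k}\prod_{b\in I_l}(1-z_b/z_a)$, $Q(z_I,h)=\prod_{k<l}\prod_{a\in I_k}\prod_{b\in I_l}(1-hz_b/z_a)$, and $\widetilde W_{\sigma_0,K}(z_I^{-1},z^{-1},h^{-1})$ is obtained from the Laurent polynomial $\widetilde W_{\sigma_0,K}(z_I,z,h)$ by substituting $z_i\mapsto z_i^{-1}$ ($i=1..n$) and $h\mapsto h^{-1}$.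
   Context: Fix $N,n$, $\lambda\in\mathbb Z_{\ge0}^N$ with $\sum\lambda_k=n$; $\lambda^{(k)}=\lambda_1+\dots+\lambda_k$, $\lambda^{\{1\}}=\lambda^{(1)}+\dots+\lambda^{(N-1)}$. $\mathcal I_\lambda$ = ordered partitions $I=(I_1,\dots,I_N)$ of $\{1,\dots,n\}$ with $|I_k|=\lambda_k$; $I_1\cup\dots\cup I_k=\{i^{(k)}_1<\dots<i^{(k)}_{\lambda^{(k)}}\}$; $\sigma(I)=(\sigma(I_1),\dots,\sigma(I_N))$. $p(K)$ is the number of inversions (pairs of positions $a<b$ with entries $j_a>j_b$) in the sequence obtained by listing $K_N$ in increasing order, then $K_{N-1}$ in increasing order, ..., then $K_1$ in increasing order. Weight functions: variables $t^{(k)}_a$ ($1\le k\le N-1$, $1\le a\le\lambda^{(k)}$), $z_1,\dots,z_n$, $h$; $t^{(N)}_a=z_a$. $U_I=\prod_{k=1}^{N-1}\prod_{a=1}^{\lambda^{(k)}}\Big(\prod_{c:\,i^{(k+1)}_c<i^{(k)}_a}(1-ht^{(k+1)}_c/t^{(k)}_a)\prod_{c:\,i^{(k+1)}_c>i^{(k)}_a}(1-t^{(k+1)}_c/t^{(k)}_a)\prod_{b=a+1}^{\lambda^{(k)}}\frac{1-ht^{(k)}_b/t^{(k)}_a}{1-t^{(k)}_b/t^{(k)}_a}\Big)$ ($c\in\{1..\lambda^{(k+1)}\}$), $W_I=(1-h)^{\lambda^{\{1\}}}\mathrm{Sym}_{t^{(1)}}\cdots\mathrm{Sym}_{t^{(N-1)}}U_I$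 (sum over all permutations within each group $t^{(k)}$). $W_{\sigma,I}(t,z,h)=W_{\sigma^{-1}(I)}(t,z_{\sigma(1)},\dots,z_{\sigma(n)},h)$. $E(t,h)=\prod_{k=1}^{N-1}\prod_{a,b=1}^{\lambda^{(k)}}(1-ht^{(k)}_b/t^{(k)}_a)$, $\widetilde W_{\sigma,I}=W_{\sigma,I}/E$. $f(z_I,z,h)$: substitution $t^{(k)}_a=z_{i^{(k)}_a}$ (for $\widetilde W$ this yields a Laurent polynomial in $z,h$). *)

(* Defs.v *)
From HB Require Import structures.
From mathcomp Require Import all_boot all_order all_algebra all_fingroup.
Set Implicit Arguments. Unset Strict Implicit. Unset Printing Implicit Defensive.
Import Order.TTheory GRing.Theory Num.Theory.
Local Open Scope ring_scope.

(* Conventions: indices 1..n of the paper are 'I_n (0-based);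
   the block index k = 1..N is the color j : 'I_N with k = j+1.
   An ordered partition I = (I_1,...,I_N) is a coloring I : {ffun 'I_n -> 'I_N},
   I_k = { i | I i = k-1 }. *)

Section WeightFunctions.
Variable F : fieldType.
Variables N n : nat.
Variable lam : 'I_N -> nat.

Definition coloring := {ffun 'I_n -> 'I_N}.

Definition is_part (I : coloring) : bool :=
  [forall j : 'I_N, #|[set i | I i == j]| == lam j].

Definition lamc (k : nat) : nat := (\sum_(j < N | (j < k)%N) lam j)%N.

Definition lam1 : nat := (\sum_(1 <= k < N) lamc k)%N.

(* i^{(k)}_1 < ... < i^{(k)}_{lambda^{(k)}} : increasing list of I_1 u ... u I_k
   (as 0-based nat indices); i^{(k)}_a (1-based a) = nth 0 (ilist I k) (a-1). *)
Definition ilist (I : coloring) (k : nat) : seq nat :=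
  [seq val i | i <- enum 'I_n & (val (I i) < k)%N].

Definition zf (z : 'I_n -> F) (i : nat) : F :=
  match (insub i : option 'I_n) with Some i' => z i' | None => 0 end.

(* variables t^{(k)}_a, with t^{(N)}_a = z_a (a 0-based) *)
Definition tt (t : nat -> nat -> F) (z : 'I_n -> F) (k a : nat) : F :=
  if k == N then zf z a else t k a.

Definition U (I : coloring) (t : nat -> nat -> F) (z : 'I_n -> F) (h : F) : F :=
  \prod_(1 <= k < N) \prod_(0 <= a < lamc k)
    ((\prod_(0 <= c < lamc k.+1)
        (let ic := nth 0%N (ilist I k.+1) c in
         let ia := nth 0%N (ilist I k) a in
         if (ic < ia)%N then 1 - h * tt t z k.+1 c / tt t z k a
         else if (ia < ic)%N then 1 - tt t z k.+1 c / tt t z k a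
         else 1))
     * \prod_(a.+1 <= b < lamc k)
         ((1 - h * tt t z k b / tt t z k a) / (1 - tt t z k b / tt t z k a))).

Definition permlev (k : nat) (s : 'S_(lamc k)) (t : nat -> nat -> F) : nat -> nat -> F :=
  fun k' a =>
    if k' == k then
      match (insub a : option 'I_(lamc k)) with
      | Some a' => t k (val (s a'))
      | None => t k' a
      end
    else t k' a.

Fixpoint symk (m : nat) (f : (nat -> nat -> F) -> F) : (nat -> nat -> F) -> F :=
  match m with
  | 0 => f
  | m'.+1 => fun t => \sum_(s : 'S_(lamc m'.+1)) symk m' f (permlev s t)
  end.

Definition W (I : coloring) (t : nat -> nat -> F) (z : 'I_n -> F) (h : F) : F :=
  (1 - h) ^+ lam1 * symk N.-1 (fun t' => U I t' z h) t.

(* W_{sigma,I}(t,z,h) = W_{sigma^{-1}(I)}(t, z_{sigma(1)},...,z_{sigma(n)}, h);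
   i \in sigma^{-1}(I_k) iff sigma(i) \in I_k. *)
Definition Wsig (sigma : 'S_n) (I : coloring) (t : nat -> nat -> F) (z : 'I_n -> F) (h : F) : F :=
  W [ffun i => I (sigma i)] t (fun i => z (sigma i)) h.

Definition E (t : nat -> nat -> F) (h : F) : F :=
  \prod_(1 <= k < N) \prod_(0 <= a < lamc k) \prod_(0 <= b < lamc k)
     (1 - h * t k b / t k a).

Definition tsub (I : coloring) (z : 'I_n -> F) : nat -> nat -> F :=
  fun k a => zf z (nth 0%N (ilist I k) a).

Definition Wt (sigma : 'S_n) (J I : coloring) (z : 'I_n -> F) (h : F) : F :=
  Wsig sigma J (tsub I z) z h / E (tsub I z) h.

Definition Pf (I : coloring) (z : 'I_n -> F) : F :=
  \prod_(a : 'I_n) \prod_(b : 'I_n | (val (I a) < val (I b))%N) (- (z b / z a)).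
Definition Rf (I : coloring) (z : 'I_n -> F) : F :=
  \prod_(a : 'I_n) \prod_(b : 'I_n | (val (I a) < val (I b))%N) (1 - z b / z a).
Definition Qf (I : coloring) (z : 'I_n -> F) (h : F) : F :=
  \prod_(a : 'I_n) \prod_(b : 'I_n | (val (I a) < val (I b))%N) (1 - h * z b / z a).

Definition seqK (K : coloring) : seq nat :=
  flatten [seq [seq val i | i <- enum 'I_n & K i == j] | j <- rev (enum 'I_N)].
Definition inversions (s : seq nat) : nat :=
  (\sum_(0 <= a < size s) \sum_(a.+1 <= b < size s)
      (nth 0 s b < nth 0 s a)%N)%N.
Definition pinv (K : coloring) : nat := inversions (seqK K).

End WeightFunctions.

Definition sigma0 (n : nat) : 'S_n := perm (@rev_ord_inj n).

(* Main.v *)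
(* Index the variables t^(k) by the positions i with color I i < k instead of by
   their ranks. Then W_I is a nested sum over injections of the level sets of I
   into those of the evaluation point, and exchanging two adjacent positions p, q
   never relabels anything. Two facts give the theorem.
   - Exchange relation: if I p < I q, then W_I(t, z_s) and W_{sI}(t, z_s), s = (p q),
     are explicit combinations of W_I(t, z) and W_{sI}(t, z). Level by level this
     is an identity between rational functions in two t's and two z's.
   - Triangularity: if J is weakly increasing, W_J vanishes at every z_I with
     I <> J, and the dual function of K vanishes at z_J unless K = J.
   The sum over I is unchanged when (z, I) is replaced by (z_s, I_s), so the
   exchange relations of the two families, whose coefficients are adjoint to each
   other, carry the orthogonality from sJ to J; one ends at the weakly
   increasing J, where a single explicit term survives. *)
Require Import Defs.
From HB Require Import structures.
From mathcomp Require Import all_boot all_order all_algebra all_fingroup.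
From mathcomp Require Import zify ring.
Set Implicit Arguments. Unset Strict Implicit. Unset Printing Implicit Defensive.
Import Order.TTheory GRing.Theory Num.Theory.
Local Open Scope ring_scope.

(** Each orbit in P has two elements and is counted at the one of smaller [enum_rank]. Adding the
    sum to its own reindexing would only give twice the sum, which says nothing in characteristic
    2. *)
Lemma sum_involution_cancel (V : zmodType) (T : finType) (P : pred T)
    (sig : T -> T) (G : T -> V) :
  involutive sig -> (forall x, P (sig x) = P x) ->
  (forall x, P x -> sig x != x) ->
  (forall x, P x -> G x + G (sig x) = 0) ->
  \sum_(x | P x) G x = 0.
Proof.
move=> sK Ps nfix cancel.
rewrite (bigID (fun x => (enum_rank x < enum_rank (sig x))%N)) /=.
rewrite [X in _ + X](reindex_inj (inv_inj sK)) /=.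
under [X in _ + X]eq_bigl => x do rewrite Ps sK -leqNgt.
rewrite [X in _ + X](eq_bigl (fun x => P x && (enum_rank x < enum_rank (sig x))%N)).
  by rewrite -big_split /= big1 // => x /andP[Px _]; exact: cancel.
move=> x; apply: andb_id2l => Px.
rewrite ltn_neqAle; case: eqP => //= /val_inj/enum_rank_inj ex.
by move: (nfix _ Px); rewrite -ex eqxx.
Qed.

(** * One level of the weight function *)

Section Step.
Variables (F : fieldType) (n : nat) (h : F).
Implicit Types (A B : {set 'I_n}) (t y z : 'I_n -> F) (i c : 'I_n).

(** Pairs outside the ranges of the original products get the value 1, so every product runs over
    all pairs of positions and can be reindexed by a permutation. *)
Definition cross A B i c (u v : F) : F :=
  if (i \in A) && (c \in B) then
    if (c < i)%N then 1 - h * v / u else if (i < c)%N then 1 - v / u else 1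
  else 1.

Definition inner A i b (u v : F) : F :=
  if [&& i \in A, b \in A & (i < b)%N] then (1 - h * v / u) / (1 - v / u) else 1.

(* The factor of U_I with k fixed: A and B are the sets of positions of color
   < k and < k + 1, t = t^(k) and y = t^(k+1). *)
Definition ustep A B t y : F :=
  \prod_i \prod_c (cross A B i c (t i) (y c) * inner A i c (t i) (t c)).

Lemma eq_ustep A B t t' y y' : t =1 t' -> y =1 y' ->
  ustep A B t y = ustep A B t' y'.
Proof.
by move=> et ey; apply: eq_bigr => i _; apply: eq_bigr => c _; rewrite !et ey.
Qed.

Variables p q : 'I_n.
Hypothesis pq : val q = (val p).+1.
Let s := tperm p q.

Lemma adj_neq : p != q.
Proof. by apply/eqP=> e; move: pq; rewrite e => /n_Sn. Qed.

Definition swapset A : {set 'I_n} := [set i | s i \in A].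

Definition isadj i := (i == p) || (i == q).

Lemma isadj_s i : isadj (s i) = isadj i.
Proof.
rewrite /isadj /s; case: tpermP => [->|->|/eqP/negPf-> /eqP/negPf->] //;
  by rewrite !eqxx orbT.
Qed.

Lemma sadj_id i : ~~ isadj i -> s i = i.
Proof. by rewrite negb_or => /andP[ip iq]; rewrite /s tpermD // eq_sym. Qed.

Lemma isadjP i : isadj i -> i = p \/ i = q.
Proof. by case/orP=> /eqP; [left | right]. Qed.

(** No position lies strictly between p and q, so replacing one by the other does not alter a
    comparison with a third position. *)
Lemma ltn_sl i c : ~~ (isadj i && isadj c) -> (s i < c)%N = (i < c)%N.
Proof.
have [ai /= nadj|ai _] := boolP (isadj i); last by rewrite sadj_id.
move: nadj; rewrite negb_or => /andP[cp cq].
move: pq cp cq; rewrite -!val_eqE /= => e cp cq.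
case: (isadjP ai) => ->; rewrite ?tpermL ?tpermR; lia.
Qed.

Lemma ltn_sr i c : ~~ (isadj i && isadj c) -> (i < s c)%N = (i < c)%N.
Proof.
have [ai /= nadj|ai _] := boolP (isadj c); last by rewrite sadj_id.
move: nadj; rewrite andbT negb_or => /andP[cp cq].
move: pq cp cq; rewrite -!val_eqE /= => e cp cq.
case: (isadjP ai) => ->; rewrite ?tpermL ?tpermR; lia.
Qed.

Lemma ltn_ss i c : ~~ (isadj i && isadj c) -> (s i < s c)%N = (i < c)%N.
Proof. by move=> na; rewrite ltn_sl ?ltn_sr ?isadj_s. Qed.

(* The part of ustep that is symmetric under the exchange of p and q. *)
Definition common A B t y : F :=
  \prod_(x : 'I_n * 'I_n | ~~ (isadj x.1 && isadj x.2))
     (cross A B x.1 x.2 (t x.1) (y x.2) * inner A x.1 x.2 (t x.1) (t x.2)).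

(** Of the eight factors at pairs inside {p, q}, the diagonal ones and [inner] at (q, p) equal 1,
    which leaves three. *)
Lemma ustepE A B t y :
  ustep A B t y = common A B t y *
    (cross A B p q (t p) (y q) * inner A p q (t p) (t q) *
     cross A B q p (t q) (y p)).
Proof.
rewrite /ustep pair_big /= (bigID (fun x => isadj x.1 && isadj x.2)) /=.
rewrite mulrC; congr (_ * _).
rewrite (eq_bigl (fun x : 'I_n * 'I_n => isadj x.1 && isadj x.2)) //.
rewrite -(pair_big isadj isadj
  (fun i c => cross A B i c (t i) (y c) * inner A i c (t i) (t c))) /=.
have adjE (G : 'I_n -> F) : \prod_(i | isadj i) G i = G p * G q.
  rewrite (bigD1 p) /= ?/isadj ?eqxx //; congr (_ * _).
  rewrite (bigD1 q) /= ?eqxx ?orbT ?(eq_sym q) ?adj_neq //.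
  rewrite big1 ?mulr1 // => i /andP[/andP[/orP[]]] /eqP->; by rewrite ?eqxx.
rewrite !adjE.
have crossd i u v : cross A B i i u v = 1 by rewrite /cross !ltnn; case: ifP.
have innerd i u v : inner A i i u v = 1 by rewrite /inner ltnn !andbF.
have innerqp u v : inner A q p u v = 1.
  by rewrite /inner [in X in if X then _ else _]pq ltnNge leqnSn !andbF.
by rewrite !crossd !innerd innerqp !mul1r !mulr1.
Qed.

(** Pairs inside {p, q} are left out of [common], so no remaining comparison is altered. The cross
    factors are reindexed in their first entry only, the inner ones in both. *)
Lemma common_swapt A B t y : swapset B = B ->
  common (swapset A) B (t \o s) y = common A B t y.
Proof.
move=> sB; rewrite /common !big_split /=; congr (_ * _).
- rewrite (reindex_inj (h := fun x : 'I_n * 'I_n => (s x.1, x.2))) /=; last first.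
    by move=> [i c] [i' c'] [] /perm_inj -> ->.
  apply: eq_big => [x|x nx]; first by rewrite isadj_s.
  rewrite isadj_s in nx.
  by rewrite /cross inE tpermK ltn_sl // ltn_sr // andbC.
- rewrite (reindex_inj (h := fun x : 'I_n * 'I_n => (s x.1, s x.2))) /=; last first.
    by move=> [i c] [i' c'] [] /perm_inj -> /perm_inj ->.
  apply: eq_big => [x|x nx]; first by rewrite !isadj_s.
  rewrite !isadj_s in nx.
  by rewrite /inner !inE !tpermK ltn_sl ?isadj_s // ltn_sr.
Qed.

Lemma common_swapy A B t y : swapset B = B ->
  common A B t (y \o s) = common A B t y.
Proof.
move=> sB; rewrite /common !big_split /=; congr (_ * _).
rewrite (reindex_inj (h := fun x : 'I_n * 'I_n => (x.1, s x.2))) /=; last first.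
  by move=> [i c] [i' c'] [] -> /perm_inj ->.
apply: eq_big => [x|x nx]; first by rewrite isadj_s.
rewrite isadj_s in nx.
rewrite /cross tpermK -{1}sB inE tpermK ltn_sr // ltn_sl //.
by rewrite andbC.
Qed.

(** The only comparison that the transposition reverses is that of p with q; as these do not both
    lie in B, the factors of that pair are 1 on both sides. *)
Lemma ustep_relabel A B t y : A \subset B -> ~~ ((p \in B) && (q \in B)) ->
  ustep (swapset A) (swapset B) (t \o s) (y \o s) = ustep A B t y.
Proof.
move=> sAB npq; rewrite /ustep !pair_big /=.
rewrite (reindex_inj (h := fun x : 'I_n * 'I_n => (s x.1, s x.2))) /=; last first.
  by move=> [i c] [i' c'] [] /perm_inj -> /perm_inj ->.
apply: eq_bigr => -[i c] _ /=; rewrite !tpermK.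
have [/andP[ai ac]|na] := boolP (isadj i && isadj c); last first.
  rewrite /cross /inner !inE !tpermK.
  by rewrite !ltn_ss // andbC.
have [eic|nic] := eqVneq i c.
  by rewrite eic /cross /inner !inE !tpermK !ltnn.
have nB : (i \in A) && (c \in B) = false.
  apply/negP=> /andP[iA cB]; move/negP: npq; apply.
  move: (subsetP sAB _ iA) => iB.
  case: (isadjP ai) => ei; case: (isadjP ac) => ec; move: nic;
    by rewrite ?ei ?ec ?eqxx -?ei -?ec ?iB ?cB.
have nA : (i \in A) && (c \in A) = false.
  by apply/negP=> /andP[iA cA]; rewrite iA (subsetP sAB _ cA) in nB.
by rewrite /cross /inner !inE !tpermK nB !andbA nA.
Qed.

End Step.

(** * Nested sums over injections *)

Section WW.
Variables (F : fieldType) (n : nat).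
Implicit Types (A D : {set 'I_n}) (t y z : 'I_n -> F).
Implicit Type f : {ffun 'I_n -> option 'I_n}.

(* f is an injection A -> D, extended by None so that each injection is
   counted once. *)
Definition injto A D f : bool :=
  [&& [forall i, (f i == None) == (i \notin A)],
      [forall i, if f i is Some d then d \in D else true] &
      [forall i, forall j, (i \in A) && (f i == f j) ==> (i == j)]].

Definition osub z f (i : 'I_n) : F := if f i is Some d then z d else 0.

Lemma injtoP A D f : reflect
  [/\ forall i, i \notin A -> f i = None,
      forall i, i \in A -> exists2 d, f i = Some d & d \in D &
      {in A, injective f}] (injto A D f).
Proof.
apply: (iffP and3P) => [[/forallP f1 /forallP f2 /forallP f3]|[f1 f2 f3]]; split.
- by move=> i iA; apply/eqP; rewrite (eqP (f1 i)).
- move=> i iA; move: (f1 i) (f2 i); rewrite iA.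
  by case: (f i) => // d _ dD; exists d.
- move=> i iA j e; move/forallP/(_ j): (f3 i); rewrite iA e eqxx /=.
  by move/eqP.
- apply/forallP=> i; case: (boolP (i \in A)) => iA; last by rewrite f1.
  by case: (f2 _ iA) => d ->.
- apply/forallP=> i; case: (boolP (i \in A)) => iA; last by rewrite f1.
  by case: (f2 _ iA) => d ->.
- apply/forallP=> i; apply/forallP=> j; apply/implyP=> /andP[iA /eqP e].
  by apply/eqP; apply: f3.
Qed.

(* Sum over t^(1), ..., t^(k), with y = t^(k+1); the values of t^(j) are
   the z d with d in D j. *)
Fixpoint wsum (h : F) (A D : nat -> {set 'I_n}) z (k : nat) y : F :=
  if k is k'.+1 then
    \sum_(f | injto (A k) (D k) f)
      ustep h (A k) (A k.+1) (osub z f) y * wsum h A D z k' (osub z f)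
  else 1.

Lemma wsumS h (A D : nat -> {set 'I_n}) z k y :
  wsum h A D z k.+1 y = \sum_(f | injto (A k.+1) (D k.+1) f)
    ustep h (A k.+1) (A k.+2) (osub z f) y * wsum h A D z k (osub z f).
Proof. by []. Qed.

Lemma eq_wsum h (A A' D D' : nat -> {set 'I_n}) z z' k y y' : A =1 A' -> D =1 D' -> z =1 z' -> y =1 y' ->
  wsum h A D z k y = wsum h A' D' z' k y'.
Proof.
move=> eA eD ez; elim: k y y' => [|k IH] y y' ey //=.
rewrite !eA eD; apply: eq_bigr => f _.
have eo : osub z f =1 osub z' f by move=> i; rewrite /osub; case: (f i).
by rewrite (eq_ustep _ _ _ eo ey) (IH _ _ eo).
Qed.

Definition fcomp (p q : 'I_n) f : {ffun 'I_n -> option 'I_n} :=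
  [ffun i => f (tperm p q i)].

Lemma fcompK p q : involutive (fcomp p q).
Proof. by move=> f; apply/ffunP=> i; rewrite !ffunE tpermK. Qed.

Lemma injto_fcomp p q A D f : injto (swapset p q A) D (fcomp p q f) = injto A D f.
Proof.
apply/injtoP/injtoP => -[f1 f2 f3]; split.
- by move=> i iA; move: (f1 (tperm p q i)); rewrite ffunE inE tpermK => ->.
- by move=> i iA; move: (f2 (tperm p q i)); rewrite ffunE inE tpermK; apply.
- move=> i iA j e; apply: (@perm_inj _ (tperm p q)); apply: f3.
    by rewrite inE tpermK.
  by rewrite !ffunE !tpermK.
- by move=> i; rewrite inE ffunE => /f1.
- by move=> i; rewrite inE ffunE => /f2.
- by move=> i; rewrite inE !ffunE => iA j; rewrite ffunE => /f3-/(_ iA)/perm_inj.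
Qed.

Lemma osub_fcomp p q z f : osub z (fcomp p q f) =1 osub z f \o tperm p q.
Proof. by move=> i; rewrite /osub ffunE. Qed.

(** The levels are nested, so p and q do not both lie in any lower level either, and [ustep_relabel]
    applies all the way down after f is reindexed to f o s. *)
Lemma wsum_relabel h (p q : 'I_n) (A D : nat -> {set 'I_n}) z k y :
  val q = (val p).+1 ->
  (forall j, A j \subset A j.+1) -> ~~ ((p \in A k.+1) && (q \in A k.+1)) ->
  wsum h (fun j => swapset p q (A j)) D z k (y \o tperm p q) = wsum h A D z k y.
Proof.
move=> pq Amono; elim: k y => [|k IH] y npq //=.
rewrite (reindex_inj (inv_inj (@fcompK p q))) /=.
under eq_bigl => f do rewrite injto_fcomp.
apply: eq_bigr => f _.
rewrite (eq_ustep _ _ _ (osub_fcomp p q z f) (frefl _)) ustep_relabel //.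
congr (_ * _).
rewrite (eq_wsum _ _ (frefl _) (frefl _) (frefl _) (osub_fcomp p q z f)) IH //.
by apply: contra npq => /andP[pA qA]; rewrite !(subsetP (Amono k.+1)).
Qed.

(** The elements of the sets D j only label values of z. Composing each injection with the renaming
    s matches the two sums term by term. *)
Lemma wsum_target h (s : {perm 'I_n}) (A D D' : nat -> {set 'I_n}) z k y :
  (forall j i, (s i \in D j) = (i \in D' j)) ->
  wsum h A D' (z \o s) k y = wsum h A D z k y.
Proof.
move=> eD; elim: k y => [|k IH] y //=.
pose g (u : {perm 'I_n}) f : {ffun 'I_n -> option 'I_n} := [ffun i => omap u (f i)].
have gK u : cancel (g u) (g u^-1%g).
  by move=> f; apply/ffunP=> i; rewrite !ffunE; case: (f i) => //= d; rewrite permK.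
rewrite [RHS](reindex_inj (can_inj (gK s))) /=.
have io (f : {ffun 'I_n -> option 'I_n}) : injto (A k.+1) (D k.+1) (g s f) = injto (A k.+1) (D' k.+1) f.
  have oi : injective (omap s) by move=> [a|] [b|] // [] /perm_inj ->.
  apply/injtoP/injtoP => -[f1 f2 f3]; split.
  - by move=> i /f1; rewrite ffunE; case: (f i).
  - move=> i /f2[d]; rewrite ffunE; case: (f i) => //= d' [<-].
    by rewrite eD; exists d'.
  - by move=> i iA j e; apply: f3; rewrite // !ffunE e.
  - by move=> i /f1; rewrite ffunE => ->.
  - by move=> i /f2[d e dD]; exists (s d); rewrite ?ffunE ?e ?eD.
  - by move=> i iA j; rewrite !ffunE => /oi; apply: f3.
apply: eq_big => [f|f _]; first by rewrite io.
have eo : osub (z \o s) f =1 osub z (g s f).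
  by move=> i; rewrite /osub ffunE; case: (f i).
by rewrite (eq_ustep _ _ _ eo (frefl _)) IH (eq_wsum _ _ (frefl _) (frefl _) (frefl _) eo).
Qed.

End WW.

(** * Exchange relation *)

Section PairFactor.
Variable F : fieldType.
Implicit Types h t u x y g : F.

(** The factors of one level at the pair p, q when both lie in A: t and u are the values of t^(k) at
    p and q, x and y those of t^(k+1). *)
Definition pairf h t u x y : F :=
  (1 - y / t) * ((1 - h * u / t) / (1 - u / t)) * (1 - h * x / u).

Lemma sub1_div (a b : F) : b != 0 -> 1 - a / b = (b - a) / b.
Proof. by move=> b0; field. Qed.

(** The terms are grouped for the involution f -> f o s: the bracket is the first difference with t
    and u exchanged. *)
Lemma pairf_sym h t u x y : t != 0 -> u != 0 -> t != u ->
  pairf h t u y x - pairf h t u x y + (pairf h u t y x - pairf h u t x y) = 0.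
Proof.
move=> t0 u0 tu; have ut : u - t != 0 by rewrite subr_eq0 eq_sym.
move: tu; rewrite -subr_eq0 => tu.
rewrite /pairf ![1 - u / t]sub1_div // ![1 - t / u]sub1_div //.
by field; rewrite t0 u0 tu ut.
Qed.

Section Exchange.
Variables h t u x y g1 g2 g1' g2' : F.
Hypotheses (t0 : t != 0) (u0 : u != 0) (tu : t != u) (htu : h * t != u).
Hypotheses (e1 : (u - h * t) * g1' = (1 - h) * t * g1 + (u - t) * g2)
           (e2 : (u - h * t) * g2' = (1 - h) * u * g2 + h * (u - t) * g1).

Let solve_g : [/\ t - u != 0, u - t != 0, u - h * t != 0,
  g1' = ((1 - h) * t * g1 + (u - t) * g2) / (u - h * t) &
  g2' = ((1 - h) * u * g2 + h * (u - t) * g1) / (u - h * t)].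
Proof.
have d : u - h * t != 0 by rewrite subr_eq0 eq_sym.
by split; rewrite ?subr_eq0 // 1?eq_sym // -?e1 -?e2; field.
Qed.

(** Here g1 and g2 stand for the lower levels of I and of I o s at (t, u), and g1', g2' for the same
    at (u, t), so that [e1] and [e2] are the exchange relation one level down. Eliminating g1' and
    g2' leaves a rational identity valid for arbitrary g1 and g2. *)
Lemma pairf_exchange1 :
  (y - h * x) * (pairf h t u y x * g1)
   - ((1 - h) * x * (pairf h t u x y * g1) + (y - x) * (pairf h t u x y * g2))
  + ((y - h * x) * (pairf h u t y x * g1')
   - ((1 - h) * x * (pairf h u t x y * g1') + (y - x) * (pairf h u t x y * g2'))) = 0.
Proof.
have [d1 d2 d3 -> ->] := solve_g.
rewrite /pairf ![1 - u / t]sub1_div // ![1 - t / u]sub1_div //.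
by field; rewrite t0 u0 d1 d2 d3.
Qed.

Lemma pairf_exchange2 :
  (y - h * x) * (pairf h t u y x * g2)
   - ((1 - h) * y * (pairf h t u x y * g2) + h * (y - x) * (pairf h t u x y * g1))
  + ((y - h * x) * (pairf h u t y x * g2')
   - ((1 - h) * y * (pairf h u t x y * g2') + h * (y - x) * (pairf h u t x y * g1'))) = 0.
Proof.
have [d1 d2 d3 -> ->] := solve_g.
rewrite /pairf ![1 - u / t]sub1_div // ![1 - t / u]sub1_div //.
by field; rewrite t0 u0 d1 d2 d3.
Qed.

End Exchange.
End PairFactor.

Section Exchange.
Variables (F : fieldType) (n : nat) (h : F) (z : 'I_n -> F).
Hypotheses (z0 : forall i, z i != 0) (zd : forall i j, i != j -> z i != z j)
  (hz : forall i j, h * z i != z j).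
Variables p q : 'I_n.
Hypothesis pq : val q = (val p).+1.
Let s := tperm p q.
Implicit Types (A B : {set 'I_n}) (t y : 'I_n -> F) (I : 'I_n -> nat).

Definition lev I (k : nat) : {set 'I_n} := [set i | (I i < k)%N].

Lemma lev_mono I k : lev I k \subset lev I k.+1.
Proof. by apply/subsetP=> i; rewrite !inE => /ltnW. Qed.

Lemma lev_comp I k : lev (I \o s) k = swapset p q (lev I k).
Proof. by apply/setP=> i; rewrite !inE. Qed.

Lemma swapset_both A : (p \in A) = (q \in A) -> swapset p q A = A.
Proof.
move=> e; apply/setP=> i; rewrite !inE.
by case: tpermP => [->|->|//]; rewrite e.
Qed.

Let pltq : (p < q)%N. Proof. by rewrite pq. Qed.
Let qltp : (q < p)%N = false. Proof. by rewrite pq ltnNge leqnSn. Qed.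
Let pq' : p != q := adj_neq pq.

Lemma ustep_both A B t y : A \subset B -> p \in A -> q \in A ->
  ustep h A B t y = common h p q A B t y * pairf h (t p) (t q) (y p) (y q).
Proof.
move=> sAB pA qA; rewrite (ustepE _ pq) /cross /inner pA qA !(subsetP sAB) //=.
by rewrite pltq qltp.
Qed.

Lemma ustep_left A B t y : p \in A -> q \notin A -> q \in B ->
  ustep h A B t y = common h p q A B t y * (1 - y q / t p).
Proof.
move=> pA /negPf qA qB; rewrite (ustepE _ pq) /cross /inner pA qA qB /=.
by rewrite pltq qltp !mulr1.
Qed.

Lemma ustep_right A B t y : q \in A -> p \notin A -> p \in B ->
  ustep h A B t y = common h p q A B t y * (1 - h * y p / t q).
Proof.
move=> pA /negPf qA qB; rewrite (ustepE _ pq) /cross /inner pA qA qB /=.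
by rewrite pltq !mul1r.
Qed.

Lemma ustep_none A B t y : p \notin A -> q \notin A ->
  ustep h A B t y = common h p q A B t y.
Proof.
move=> /negPf pA /negPf qA; rewrite (ustepE _ pq) /cross /inner pA qA /=.
by rewrite !mulr1.
Qed.

Lemma eq_common A B t t' y y' : t =1 t' -> y =1 y' ->
  common h p q A B t y = common h p q A B t' y'.
Proof. by move=> et ey; apply: eq_bigr => x _; rewrite !et ey. Qed.

Lemma common_osub A B f y : swapset p q B = B ->
  common h p q (swapset p q A) B (osub z (fcomp p q f)) y
   = common h p q A B (osub z f) y.
Proof.
move=> sB; rewrite -(common_swapt h pq A (osub z f) _ sB).
exact: eq_common (osub_fcomp _ _ _ _) (frefl _).
Qed.

Lemma fcomp_neq A D f : p \in A -> injto A D f -> fcomp p q f != f.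
Proof.
move=> pA /injtoP[_ _ finj]; apply/eqP=> /ffunP/(_ p).
by rewrite ffunE tpermL => /esym/(finj _ pA)/eqP; rewrite (negPf pq').
Qed.

Lemma osub_pq A D f : p \in A -> q \in A -> injto A D f ->
  [/\ osub z f p != 0, osub z f q != 0, osub z f p != osub z f q &
      h * osub z f p != osub z f q].
Proof.
move=> pA qA /injtoP[_ fA finj].
have [d ed _] := fA _ pA; have [d' ed' _] := fA _ qA.
rewrite /osub ed ed'; split=> //; apply: zd.
by apply/eqP=> dd; case/eqP: pq'; apply: finj; rewrite // ed ed' dd.
Qed.

Variable D : nat -> {set 'I_n}.
Notation wwI I := (wsum h (lev I) D z).

(** Induction on the number of levels, with the outer variables y arbitrary. If p and q both lie in
    the top level, the terms of f and f o s cancel together by the identities for [pairf], fed with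
    the relation one level down. If only p does, the lower levels of I and I o s agree up to
    relabeling. The symmetric case of equal colors is carried along. *)
Lemma wsum_exchange I k :
  (forall y, I p = I q -> (I p < k.+1)%N -> wwI I k (y \o s) = wwI I k y) /\
  (forall y, (I p < I q)%N -> (I q < k.+1)%N ->
    (y q - h * y p) * wwI I k (y \o s)
      = (1 - h) * y p * wwI I k y + (y q - y p) * wwI (I \o s) k y /\
    (y q - h * y p) * wwI (I \o s) k (y \o s)
      = (1 - h) * y q * wwI (I \o s) k y + h * (y q - y p) * wwI I k y).
Proof.
elim: k => [|k [IHeq IHlt]]; first by split=> // y; case: (I q) => // m; rewrite !ltnS ltn0.
set A := lev I k.+1; set B := lev I k.+2.
have sAB : A \subset B := lev_mono I k.+1.
have inA i : (i \in A) = (I i < k.+1)%N by rewrite inE.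
have inB i : (i \in B) = (I i < k.+2)%N by rewrite inE.
have wwcomp f j : wwI I j (osub z (fcomp p q f)) = wwI I j (osub z f \o s).
  exact: eq_wsum (osub_fcomp p q z f).
have osubpq f : osub z (fcomp p q f) p = osub z f q /\ osub z (fcomp p q f) q = osub z f p.
  by rewrite !osub_fcomp /= tpermL tpermR.
(* Precomposition with s has no fixed point among the injections of A when p and q both lie in A. *)
have involA (G : _ -> F) : p \in A -> q \in A ->
    (forall f, injto A (D k.+1) f -> G f + G (fcomp p q f) = 0) ->
    \sum_(f | injto A (D k.+1) f) G f = 0.
  move=> pA qA; apply: (sum_involution_cancel (@fcompK _ p q)) => f.
    by rewrite -{1}(@swapset_both A) ?injto_fcomp // pA qA.
  exact: fcomp_neq.
have cE f y : swapset p q B = B -> p \in A -> q \in A ->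
    common h p q A B (osub z (fcomp p q f)) y = common h p q A B (osub z f) y.
  by move=> sB pA qA; rewrite -{1}(@swapset_both A) ?common_osub // pA qA.
have sy y : (y \o s) p = y q /\ (y \o s) q = y p.
  by rewrite /s /= tpermL tpermR.
split=> y.
- move=> Ipq Ip.
  have sB : swapset p q B = B by rewrite swapset_both // !inB Ipq.
  (* If neither p nor q is in A, only [common] is left of this level, and it is symmetric in y. *)
  have [pA|pA] := boolP (p \in A); last first.
    have qA : q \notin A by rewrite inA -Ipq -inA.
    apply: eq_bigr => f _.
    by rewrite !(ustep_none _ _ _ pA qA) (common_swapy h pq _ _ _ sB).
  have qA : q \in A by rewrite inA -Ipq -inA.
  apply/eqP; rewrite !wsumS -subr_eq0 -sumrB; apply/eqP.
  apply: involA => // f If.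
  rewrite !(ustep_both _ _ sAB pA qA) !(common_swapy h pq _ _ _ sB).
  rewrite !cE // (sy y).1 (sy y).2 (osubpq f).1 (osubpq f).2.
  rewrite wwcomp IHeq ?Ipq -?inA //.
  have [t0 u0 tu _] := osub_pq pA qA If.
  set w := wwI _ _ _; set c := common _ _ _ _ _ _ _.
  rewrite -!mulrBl -!mulrBr -mulrDl -mulrDr.
  by rewrite pairf_sym // mulr0 mul0r.
- move=> Ipq Iq.
  have sB : swapset p q B = B by rewrite swapset_both // !inB Iq (ltn_trans Ipq).
  have pA : p \in A by rewrite inA (leq_trans Ipq).
  (* When q is in A as well, I and I o s have the same level sets here and one level up, so their
     sums run over the same injections with the same factors and differ only in the lower levels. *)
  have [qA|qA] := boolP (q \in A).
    have AI : lev (I \o s) k.+1 = A by rewrite lev_comp swapset_both // pA.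
    have BI : lev (I \o s) k.+2 = B by rewrite lev_comp.
    have Iqk : (I q < k.+1)%N by rewrite -inA.
    split; apply/eqP; rewrite -subr_eq0; apply/eqP.
    + rewrite !wsumS.
      rewrite AI BI -/A -/B.
      rewrite !mulr_sumr -big_split -sumrB /=.
      apply: involA => // f If.
      rewrite !(ustep_both _ _ sAB pA qA) !(common_swapy h pq _ _ _ sB).
      rewrite !cE // (sy y).1 (sy y).2 (osubpq f).1 (osubpq f).2.
      have [t0 u0 tu htu] := osub_pq pA qA If.
      have [e1 e2] := IHlt (osub z f) Ipq Iqk.
      rewrite !wwcomp.
      have -> : wwI (I \o s) k (osub z (fcomp p q f)) = wwI (I \o s) k (osub z f \o s).
        exact: eq_wsum (osub_fcomp p q z f).
      have := pairf_exchange1 (y p) (y q) t0 u0 tu htu e1 e2.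
      move/(congr1 ( *%R (common h p q A B (osub z f) y))); rewrite mulr0 => <-.
      ring.
    + rewrite !wsumS.
      rewrite AI BI -/A -/B.
      rewrite !mulr_sumr -big_split -sumrB /=.
      apply: involA => // f If.
      rewrite !(ustep_both _ _ sAB pA qA) !(common_swapy h pq _ _ _ sB).
      rewrite !cE // (sy y).1 (sy y).2 (osubpq f).1 (osubpq f).2.
      have [t0 u0 tu htu] := osub_pq pA qA If.
      have [e1 e2] := IHlt (osub z f) Ipq Iqk.
      rewrite !wwcomp.
      have -> : wwI (I \o s) k (osub z (fcomp p q f)) = wwI (I \o s) k (osub z f \o s).
        exact: eq_wsum (osub_fcomp p q z f).
      have := pairf_exchange2 (y p) (y q) t0 u0 tu htu e1 e2.
      move/(congr1 ( *%R (common h p q A B (osub z f) y))); rewrite mulr0 => <-.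
      ring.
  have pB : p \in B by apply: subsetP sAB _ pA.
  have qB : q \in B by rewrite inB.
  (* Now p is in A and q is not. Reindexing by f -> f o s and relabeling the lower levels brings the
     sum for I o s to the injections used for I; only one factor differs from that in [wI]. *)
  have wIs v : wwI (I \o s) k.+1 v = \sum_(f | injto A (D k.+1) f)
      common h p q A B (osub z f) v * (1 - h * v p / osub z f p) * wwI I k (osub z f).
    rewrite wsumS (reindex_inj (inv_inj (@fcompK _ p q))) /= !lev_comp -/A -/B sB.
    under eq_bigl => f do rewrite injto_fcomp.
    apply: eq_bigr => f _.
    rewrite ustep_right ?inE ?tpermL ?tpermR -?inA -?inB //.
    rewrite common_osub // (osubpq f).2; congr (_ * _).
    rewrite -(wsum_relabel _ _ _ _ pq (lev_mono I)); last by rewrite negb_and qA orbT.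
    exact: (eq_wsum _ _ (lev_comp I) (frefl D) (frefl z) (osub_fcomp p q z f)).
  have wI v : wwI I k.+1 v = \sum_(f | injto A (D k.+1) f)
      common h p q A B (osub z f) v * (1 - v q / osub z f p) * wwI I k (osub z f).
    by apply: eq_bigr => f _; rewrite ustep_left.
  rewrite !wIs !wI !mulr_sumr -!big_split /=.
  (* Termwise the relations are now identities between the factors 1 - y/t and 1 - h x/t, with x and
     y the values at p and q. *)
  split; apply: eq_bigr => f _; rewrite (common_swapy h pq _ _ _ sB);
    rewrite /s ?tpermL ?tpermR; ring.
Qed.

End Exchange.

(** * Triangularity and diagonal values *)

Section Triangularity.
Variables (F : fieldType) (n : nat) (h : F) (z : 'I_n -> F).
Hypotheses (z0 : forall i, z i != 0) (zd : forall i j, i != j -> z i != z j).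
Implicit Types (A B : {set 'I_n}) (t y : 'I_n -> F).
Implicit Type f : {ffun 'I_n -> option 'I_n}.

Lemma eq_in_ustep A B t t' y y' : {in A, t =1 t'} -> {in B, y =1 y'} ->
  ustep h A B t y = ustep h A B t' y'.
Proof.
move=> et ey; apply: eq_bigr => i _; apply: eq_bigr => c _; congr (_ * _).
  by rewrite /cross; case: ifP => // /andP[iA cB]; rewrite et // ey.
by rewrite /inner; case: ifP => // /and3P[iA cA _]; rewrite !et.
Qed.

(** The cross factor 1 - y c / t i is zero; all vanishing in the triangularity argument comes from
    it. *)
Lemma ustep_eq0 A B t y i c : i \in A -> c \in B -> (i < c)%N ->
  t i != 0 -> y c = t i -> ustep h A B t y = 0.
Proof.
move=> iA cB ic t0 e; rewrite /ustep (bigD1 i) //= (bigD1 c) //=.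
by rewrite /cross iA cB ic ltnNge (ltnW ic) /= e divff // subrr !mul0r.
Qed.

Definition idon A : {ffun 'I_n -> option 'I_n} :=
  [ffun i => if i \in A then Some i else None].

Lemma idon_injto A : injto A A (idon A).
Proof.
apply/injtoP; split=> i; rewrite ?ffunE.
- by move/negPf->.
- by move=> iA; rewrite iA; exists i.
- by move=> iA j; rewrite !ffunE iA; case: ifP => // _ [].
Qed.

(** By strong induction every position is fixed: if f i = d with d < i, then d is already known to
    be fixed, so f takes the value d twice. *)
Lemma injto_decr A D f : injto A D f ->
  (forall i d, i \in A -> f i = Some d -> (d \in A) && (d <= i)%N) ->
  f = idon A.
Proof.
move=> /injtoP[f1 f2 f3] fle; apply/ffunP=> i; rewrite ffunE.
case: ifP => [|/negbT/f1//].
elim: {i}(val i).+1 {-2}i (ltnSn (val i)) => // m IH i im iA.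
have [d ed _] := f2 _ iA; have /andP[dA di] := fle _ _ iA ed.
move: di; rewrite leq_eqVlt => /orP[/eqP/val_inj e|di]; first by rewrite ed e.
have ed' := IH d (leq_trans di im) dA.
by have e := f3 _ dA i (etrans ed' (esym ed)); move: di; rewrite e ltnn.
Qed.

(** Work from the top level down. If f sends i to some d > i, then d lies in the level above, where
    y d = z d equals the variable at i, and [ustep_eq0] kills the term. The surviving f never raise
    a position, which forces equal level sets and f the identity; then the same argument applies one
    level lower. *)
Lemma wsum_triangular (A D : nat -> {set 'I_n}) k y :
  (forall j, D j \subset D j.+1) -> (forall j, #|A j| = #|D j|) ->
  (forall j (i d : 'I_n), i \in A j -> (d <= i)%N -> d \in A j) \/
  (forall j (i d : 'I_n), d \in D j -> (d <= i)%N -> i \in D j) ->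
  A k.+1 = D k.+1 -> {in A k.+1, y =1 z} ->
  wsum h A D z k y
    = \prod_(1 <= j < k.+1) ((A j == D j)%:R * ustep h (A j) (A j.+1) z z).
Proof.
move=> Dmono cAD closed; elim: k y => [|k IH] y AD yz; first by rewrite big_geq.
rewrite wsumS big_nat_recr //=.
have term f : injto (A k.+1) (D k.+1) f ->
    ustep h (A k.+1) (A k.+2) (osub z f) y != 0 ->
    A k.+1 = D k.+1 /\ f = idon (A k.+1).
  move=> If u0; have [f1 f2 f3] := injtoP _ _ _ If.
  have fle i d : i \in A k.+1 -> f i = Some d -> (d \in D k.+1) && (d <= i)%N.
    move=> iA fi; have [d' fi' dD] := f2 _ iA.
    move: fi'; rewrite fi => -[ed]; rewrite -{}ed in dD; rewrite dD leqNgt.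
    apply: contra u0 => id; have dA : d \in A k.+2 by rewrite AD (subsetP (Dmono _)).
    have ti : osub z f i = z d by rewrite /osub fi.
    by rewrite (ustep_eq0 iA dA id) ?ti // yz.
  have AeqD : A k.+1 = D k.+1.
    (* If A is closed downwards, f maps A into itself, hence onto itself by injectivity, so every
       element of A is a value of f and lies in D. If D is closed upwards, f i <= i with f i in D
       already puts i in D. *)
    case: closed => [down|up].
    - have img : f @: A k.+1 \subset Some @: A k.+1.
        apply/subsetP=> _ /imsetP[i iA ->]; have [d fi dD] := f2 _ iA.
        have /andP[_ di] := fle _ _ iA fi.
        by rewrite fi imset_f // (down _ i).
      have e : f @: A k.+1 = Some @: A k.+1.
        apply/eqP; rewrite eqEcard img card_in_imset; last by move=> i j _ _ [].
        by rewrite card_in_imset ?leqnn // => i j iA _; apply: f3.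
      apply/eqP; rewrite eqEcard cAD leqnn andbT; apply/subsetP=> i iA.
      have /imsetP[j jA ej] : Some i \in f @: A k.+1 by rewrite e imset_f.
      by have /andP[] := fle _ _ jA (esym ej).
    - apply/eqP; rewrite eqEcard cAD leqnn andbT; apply/subsetP=> i iA.
      have [d fi _] := f2 _ iA; have /andP[dD di] := fle _ _ iA fi.
      exact: up dD di.
  split=> //; apply: (injto_decr If) => i d; rewrite {2}AeqD; exact: fle.
have [AeqD|nAD] := eqVneq (A k.+1) (D k.+1); last first.
  rewrite mul0r mulr0 big1 // => f If.
  apply/eqP; rewrite mulf_eq0; apply/orP; left; apply: contraT => u0.
  by have [e _] := term _ If u0; rewrite e eqxx in nAD.
have oz : {in A k.+1, osub z (idon (A k.+1)) =1 z}.
  by move=> i iA; rewrite /osub ffunE iA.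
rewrite (bigD1 (idon (A k.+1))) /=; last by rewrite -AeqD idon_injto.
rewrite big1 ?addr0 => [|f /andP[If nf]]; last first.
  apply/eqP; rewrite mulf_eq0; apply/orP; left; apply: contraT => u0.
  by have [_ e] := term _ If u0; rewrite e eqxx in nf.
by rewrite IH // mulrC mul1r; congr (_ * _); apply: eq_in_ustep.
Qed.

Definition diagf (i c : 'I_n) : F :=
  if (c < i)%N then 1 - h * z c / z i else 1 - z c / z i.

(** For i < c in A the cross factor cancels the denominator of [inner], leaving 1 - h z c / z i,
    which is also the cross factor for c < i. The missing diagonal entries are supplied by the
    powers of 1 - h. *)
Lemma ustep_diag A B : A \subset B ->
  (\prod_(i in A) (1 - h)) * ustep h A B z z
  = (\prod_(i in A) \prod_(c in A) (1 - h * z c / z i))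
    * \prod_(i in A) \prod_(c in B :\: A) diagf i c.
Proof.
move=> sAB; rewrite /ustep [X in _ * X = _](bigID (mem A)) /= mulrA -big_split -big_split /=.
rewrite [X in _ * X]big1 ?mulr1; last first.
  move=> i /negPf iA; rewrite big1 // => c _.
  by rewrite /cross /inner iA /= mulr1.
apply: eq_bigr => i iA.
have -> : 1 - h = \prod_c (if c == i then 1 - h else 1).
  by rewrite -big_mkcond big_pred1_eq.
rewrite -big_split [X in _ = X * _]big_mkcond [X in _ = _ * X]big_mkcond -big_split /=.
apply: eq_bigr => c _; rewrite /cross /inner /diagf iA !inE /=.
have [->|nci] := eqVneq c i.
  by rewrite iA !ltnn (subsetP sAB) //= !mulr1 mulfK.
have cB : c \in A -> c \in B by apply: subsetP.
rewrite mul1r; case: (ltngtP c i) => [ci|ic|e].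
- by rewrite !andbF mulr1; case: (c \in A) cB => /= [->|_]; rewrite ?mulr1 ?mul1r.
- rewrite andbT; case: (c \in A) cB => /= [->|_]; rewrite ?mulr1 ?mul1r //.
  have d : 1 - z c / z i != 0.
    by rewrite subr_eq0 eq_sym; apply: contra (zd nci) => /eqP e; rewrite -[z c](divfK (z0 i)) e mul1r.
  by rewrite mulrC divfK.
- by move/val_inj: e nci => ->; rewrite eqxx.
Qed.

(** A position c lies in level k + 1 but not in level k only for k = I c, so each pair i, c meets
    exactly one level, and it counts there when I i < I c. *)
Lemma lev_diag (I : 'I_n -> nat) N : (forall i, (I i < N)%N) ->
  \prod_(1 <= k < N) \prod_(i in lev I k) \prod_(c in lev I k.+1 :\: lev I k) diagf i c
  = \prod_i \prod_(c | (I i < I c)%N) diagf i c.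
Proof.
move=> IN.
under eq_bigr => k _ do under eq_bigr => i _ do rewrite big_mkcond.
under eq_bigr => k _ do rewrite big_mkcond.
rewrite exchange_big; apply: eq_bigr => i _.
rewrite [RHS]big_mkcond /=.
under eq_bigr => k _.
  have -> : (if i \in lev I k then
      \prod_c (if c \in lev I k.+1 :\: lev I k then diagf i c else 1) else 1)
      = \prod_c (if (I i < I c)%N && (k == I c) then diagf i c else 1).
    rewrite inE; case: ifP => Ii.
      apply: eq_bigr => c _; rewrite !inE -leqNgt ltnS -eqn_leq.
      by case: eqP => [<-|]; rewrite ?Ii ?andbF.
    by rewrite big1 // => c _; case: eqP => [<-|]; rewrite ?Ii ?andbF.
  over.
rewrite exchange_big; apply: eq_bigr => c _.
case: ltnP => Iic /=; last by rewrite big1.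
rewrite -big_mkcond big_nat1_eq IN.
by rewrite (leq_trans _ Iic).
Qed.

End Triangularity.

(** * From ranks to positions *)

Section Lists.
Variables (N n : nat) (lam : 'I_N -> nat).
Implicit Types X M : coloring N n.

Definition color X (i : 'I_n) : nat := X i.

Definition ordlist X (k : nat) : seq 'I_n := [seq i <- enum 'I_n | (X i < k)%N].

Lemma ilistE X k : ilist X k = map val (ordlist X k).
Proof. by []. Qed.

Lemma mem_olist X k i : (i \in ordlist X k) = (i \in lev (color X) k).
Proof. by rewrite mem_filter mem_enum andbT inE. Qed.

Lemma uniq_olist X k : uniq (ordlist X k).
Proof. by rewrite filter_uniq // enum_uniq. Qed.

Lemma card_lev X k : is_part lam X -> #|lev (color X) k| = lamc lam k.
Proof.
move=> /forallP pX.
rewrite -sum1_card (partition_big X (fun j : 'I_N => (j < k)%N)) => [|i]; last first.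
  by rewrite inE.
apply: eq_bigr => j jk; rewrite -(eqP (pX j)) -sum1_card; apply: eq_bigl => i.
by rewrite !inE /color; case: eqP => [->|]; rewrite ?jk ?andbF.
Qed.

Lemma size_olist X k : is_part lam X -> size (ordlist X k) = lamc lam k.
Proof.
move=> pX; rewrite -(card_lev k pX) -sum1_size -sum1_card big_filter big_enum_cond.
by apply: eq_bigl => i; rewrite !inE.
Qed.

Lemma sorted_ilist X k : sorted ltn (ilist X k).
Proof.
apply: (subseq_sorted ltn_trans) (iota_ltn_sorted 0 n).
by rewrite -val_enum_ord map_subseq // filter_subseq.
Qed.

Lemma ltn_nth_ilist X k a b : is_part lam X -> (a < lamc lam k)%N -> (b < lamc lam k)%N ->
  (nth 0 (ilist X k) a < nth 0 (ilist X k) b)%N = (a < b)%N.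
Proof.
move=> pX; rewrite -(size_olist k pX) -(size_map val) => ak bk.
have mono := sorted_ltn_nth ltn_trans 0%N (sorted_ilist X k).
case: (ltngtP a b) => [ab|ba|->]; last by rewrite ltnn.
  exact: mono.
by apply/negbTE; rewrite -leqNgt ltnW //; apply: mono.
Qed.

Lemma big_ilist (R : Type) (idx : R) (op : Monoid.com_law idx) X k (P : pred nat) (G : nat -> R) :
  is_part lam X ->
  \big[op/idx]_(0 <= a < lamc lam k | P (nth 0%N (ilist X k) a)) G (nth 0%N (ilist X k) a)
  = \big[op/idx]_(i in lev (color X) k | P (val i)) G (val i).
Proof.
move=> pX; rewrite -(size_olist k pX) -(size_map val) -ilistE.
rewrite -(big_nth 0%N P) ilistE big_map big_filter_cond big_enum_cond.
by apply: eq_bigl => i; rewrite !inE.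
Qed.

End Lists.

(** * Symmetrization over ranks as a sum over injections *)

Section Conversion.
Variables (F : fieldType) (N n : nat) (lam : 'I_N -> nat) (h : F).
Implicit Types X M : coloring N n.

(** The factor of [U] for one fixed k, still indexed by ranks; [ustep] is its counterpart indexed by
    positions. *)
Definition vstep X k (t y : nat -> F) : F :=
  \prod_(0 <= a < lamc lam k)
    ((\prod_(0 <= c < lamc lam k.+1)
        (let ic := nth 0%N (ilist X k.+1) c in
         let ia := nth 0%N (ilist X k) a in
         if (ic < ia)%N then 1 - h * y c / t a
         else if (ia < ic)%N then 1 - y c / t a
         else 1))
     * \prod_(a.+1 <= b < lamc lam k) ((1 - h * t b / t a) / (1 - t b / t a))).

Lemma UE X t z : U lam X t z h =
  \prod_(1 <= k < N) vstep X k (tt N t z k) (tt N t z k.+1).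
Proof. by []. Qed.

Lemma zf_val (T : 'I_n -> F) i : zf T (val i) = T i.
Proof. by rewrite /zf valK. Qed.

Lemma eq_vstep X k t t' y y' : t =1 t' -> y =1 y' -> vstep X k t y = vstep X k t' y'.
Proof.
move=> et ey; apply: eq_bigr => a _; congr (_ * _).
  by apply: eq_bigr => c _; rewrite et ey.
by apply: eq_bigr => b _; rewrite !et.
Qed.

Lemma vstep_ustep X k (t y : nat -> F) (T Y : 'I_n -> F) : is_part lam X ->
  (forall a, (a < lamc lam k)%N -> t a = zf T (nth 0%N (ilist X k) a)) ->
  (forall c, (c < lamc lam k.+1)%N -> y c = zf Y (nth 0%N (ilist X k.+1) c)) ->
  vstep X k t y = ustep h (lev (color X) k) (lev (color X) k.+1) T Y.
Proof.
move=> pX et ey.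
pose G (i c : nat) : F := if (c < i)%N then 1 - h * zf Y c / zf T i
  else if (i < c)%N then 1 - zf Y c / zf T i else 1.
pose G' (i b : nat) : F := (1 - h * zf T b / zf T i) / (1 - zf T b / zf T i).
pose H (i : nat) : F := (\prod_(c in lev (color X) k.+1) G i c)
   * \prod_(b in lev (color X) k | (i < b)%N) G' i b.
transitivity (\prod_(0 <= a < lamc lam k) H (nth 0%N (ilist X k) a)).
  rewrite /vstep !big_nat; apply: eq_bigr => a /andP[_ ak]; congr (_ * _).
    rewrite -(eq_bigl _ _ (fun i => andbT (i \in lev (color X) k.+1))).
    rewrite -(big_ilist _ k.+1 xpredT _ pX) !big_nat.
    by apply: eq_bigr => c /andP[_ ck] /=; rewrite ey // et.
  rewrite -(big_ilist _ k (fun b => (nth 0 (ilist X k) a < b)%N) _ pX).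
  (* The list of positions is increasing, so the condition on positions holds exactly for ranks b >
     a: the range is cut at a + 1 and its lower half contributes 1. *)
  rewrite [RHS]big_nat_cond [RHS](big_cat_nat (n := a.+1)) //=.
  rewrite [X in _ = X * _]big1_seq ?mul1r => [|b]; last first.
    rewrite mem_index_iota; case/andP=> /andP[bk].
    by rewrite (ltn_nth_ilist (lam := lam)) // => ab; rewrite /= [(b < _)%N]ltnNge ab.
  rewrite big_nat [RHS]big_nat_cond; apply: eq_big => b; last first.
    by move=> /andP[ab bk]; rewrite !et.
  case: (boolP (b < lamc lam k)%N) => bk; rewrite ?andbF // ?andbT.
  by rewrite (ltn_nth_ilist (lam := lam)) //= !andbb.
rewrite -[LHS]/(\prod_(0 <= a < lamc lam k | xpredT (nth 0%N (ilist X k) a)) _).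
rewrite big_ilist // /ustep.
under eq_bigl => i do rewrite andbT.
rewrite big_mkcond; apply: eq_bigr => i _ /=.
case: ifP => iA; last by rewrite big1 // => c _; rewrite /cross /inner iA mulr1.
rewrite /H big_mkcond [X in _ * X]big_mkcond -big_split; apply: eq_bigr => c _ /=.
by rewrite /cross /inner iA /= /G /G' !zf_val.
Qed.

Definition perm_arg k (s : 'S_(lamc lam k)) (u : nat -> F) (a : nat) : F :=
  if (insub a : option 'I_(lamc lam k)) is Some a' then u (val (s a')) else u a.

Fixpoint symsum X (t : nat -> nat -> F) k (y : nat -> F) : F :=
  if k is k'.+1 then
    \sum_(s : 'S_(lamc lam k)) vstep X k (perm_arg s (t k)) y * symsum X t k' (perm_arg s (t k))
  else 1.

Lemma symsumS X t k y : symsum X t k.+1 y =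
  \sum_(s : 'S_(lamc lam k.+1))
    vstep X k.+1 (perm_arg s (t k.+1)) y * symsum X t k (perm_arg s (t k.+1)).
Proof. by []. Qed.

Lemma eq_symsum X t t' k y y' : (forall j a, (j <= k)%N -> t j a = t' j a) ->
  y =1 y' -> symsum X t k y = symsum X t' k y'.
Proof.
elim: k y y' => // k IH y y' et ey; rewrite !symsumS; apply: eq_bigr => s _.
have ep : perm_arg s (t k.+1) =1 perm_arg s (t' k.+1).
  by move=> a; rewrite /perm_arg; case: insub => [a'|]; rewrite et.
by rewrite (eq_vstep _ _ ep ey) (IH _ _ _ ep) // => j a jk; rewrite et // leqW.
Qed.

Lemma eq_symk m (f g : (nat -> nat -> F) -> F) t : f =1 g ->
  symk lam m f t = symk lam m g t.
Proof. by move=> fg; elim: m t => //= m IH t; apply: eq_bigr => s _. Qed.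

Lemma symk_factor m (f c : (nat -> nat -> F) -> F) t :
  (forall k (s : 'S_(lamc lam k)) t', (k <= m)%N -> c (permlev s t') = c t') ->
  symk lam m (fun t' => f t' * c t') t = symk lam m f t * c t.
Proof.
elim: m t => //= m IH t cE; rewrite mulr_suml; apply: eq_bigr => s _.
by rewrite IH ?cE // => k s' t' km; rewrite cE // leqW.
Qed.

Lemma tt_permlev (z : 'I_n -> F) k (s : 'S_(lamc lam k)) t j : (k < j)%N ->
  tt N (permlev s t) z j =1 tt N t z j.
Proof.
by move=> kj a; rewrite /tt /permlev (gtn_eqF kj).
Qed.

(** The outermost sum permutes the highest group of variables. The last factor involves only that
    group and the one above it, so it comes out of the inner symmetrizations, and induction handles
    the rest. *)
Lemma symk_symsum X (z : 'I_n -> F) m t : (m < N)%N ->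
  symk lam m (fun t' => \prod_(1 <= k < m.+1) vstep X k (tt N t' z k) (tt N t' z k.+1)) t
  = symsum X t m (tt N t z m.+1).
Proof.
elim: m t => [|m IH] t mN; first by rewrite /= big_geq.
rewrite /=; apply: eq_bigr => s _.
under eq_symk do rewrite big_nat_recr //=.
rewrite symk_factor => [|k s' t' km]; last first.
  by apply: eq_vstep; apply: tt_permlev; rewrite ?ltnS // leqW.
rewrite (IH _ (ltnW mN)) mulrC.
have ep : tt N (permlev s t) z m.+1 =1 perm_arg s (t m.+1).
  by move=> a; rewrite /tt ltn_eqF // /permlev eqxx /perm_arg; case: insub.
rewrite (eq_vstep _ _ ep (@tt_permlev _ _ _ _ _ _)) //; congr (_ * _).
apply: eq_symsum => // j a jm.
by rewrite /permlev ltn_eqF.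
Qed.

Section Biject.
Variables (X M : coloring N n) (k : nat).
Hypotheses (pX : is_part lam X) (pM : is_part lam M).

Definition perm_nat (s : 'S_(lamc lam k)) (a : nat) : nat :=
  if (insub a : option 'I_(lamc lam k)) is Some a' then val (s a') else a.

(** The position of rank a in the level set of X goes to the position of rank s a in that of M. Both
    sets have [lamc lam k] elements, so permutations correspond bijectively to injections. *)
Definition pfun (s : 'S_(lamc lam k)) : {ffun 'I_n -> option 'I_n} :=
  [ffun i => if i \in lev (color X) k then
     Some (nth i (ordlist M k) (perm_nat s (index i (ordlist X k)))) else None].

Lemma index_olt (Y : coloring N n) i : is_part lam Y -> i \in lev (color Y) k ->
  (index i (ordlist Y k) < lamc lam k)%N.
Proof. by move=> pY iA; rewrite -(size_olist k pY) index_mem mem_olist. Qed.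

Lemma perm_nat_lt s a : (a < lamc lam k)%N -> (perm_nat s a < lamc lam k)%N.
Proof. by move=> ak; rewrite /perm_nat insubT ltn_ord. Qed.

Lemma perm_natE s (a : 'I_(lamc lam k)) : perm_nat s a = s a.
Proof. by rewrite /perm_nat valK. Qed.

Lemma pfun_injto s : injto (lev (color X) k) (lev (color M) k) (pfun s).
Proof.
apply/injtoP; split=> i.
- by move/negPf=> iA; rewrite ffunE iA.
- move=> iA; rewrite ffunE iA; eexists; first by [].
  by rewrite -mem_olist mem_nth // (size_olist k pM) perm_nat_lt // index_olt.
- move=> iA j; rewrite !ffunE iA; case: ifP => // jA [] /eqP.
  have Li := index_olt pX iA; have Lj := index_olt pX jA.
  rewrite (set_nth_default j) ?(size_olist k pM) ?perm_nat_lt //.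
  rewrite nth_uniq ?(size_olist k pM) ?perm_nat_lt ?uniq_olist //.
  rewrite -[index i _]/(val (Ordinal Li)) -[index j _]/(val (Ordinal Lj)) !perm_natE.
  move/eqP/val_inj/perm_inj/(congr1 val) => /= e.
  by rewrite -[i](nth_index i (s := ordlist X k)) ?mem_olist // e nth_index ?mem_olist.
Qed.

Lemma pfun_inj : injective pfun.
Proof.
move=> s s' e; apply/permP=> a; apply: val_inj; rewrite /= -!perm_natE.
have ax : (a < size (ordlist X k))%N by rewrite (size_olist k pX).
case E : (ordlist X k) ax => [//|i0 l]; rewrite -E => ax.
set i := nth i0 (ordlist X k) a.
have iA : i \in lev (color X) k by rewrite -mem_olist mem_nth.
have ia : index i (ordlist X k) = a by rewrite index_uniq ?uniq_olist.
move/ffunP/(_ i): e; rewrite !ffunE iA ia => -[] /eqP.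
by rewrite nth_uniq ?(size_olist k pM) ?perm_nat_lt ?uniq_olist // => /eqP.
Qed.

Lemma pfun_surj f : injto (lev (color X) k) (lev (color M) k) f -> exists s, f = pfun s.
Proof.
move=> /injtoP[f1 f2 f3].
(* A default position i0 is needed for [nth]; for n = 0 there is none, but then all finite functions
   agree. *)
have [i0 _|n0] := pickP (@predT 'I_n); last first.
  by exists 1%g; apply/ffunP=> i; have := n0 i.
pose x (a : 'I_(lamc lam k)) := nth i0 (ordlist X k) a.
have xA a : x a \in lev (color X) k.
  by rewrite -mem_olist mem_nth // (size_olist k pX).
have fx a : exists2 d, f (x a) = Some d & d \in lev (color M) k by apply: f2.
pose g (a : 'I_(lamc lam k)) := odflt i0 (f (x a)).
have gD a : g a \in lev (color M) k by rewrite /g; have [d ->] := fx a.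
have gf a : f (x a) = Some (g a) by rewrite /g; have [d ->] := fx a.
pose r a := Ordinal (index_olt pM (gD a)).
have rinj : injective r.
  move=> a b /(congr1 val) /= e; apply: val_inj.
  have e' : g a = g b.
    by rewrite -[g a](nth_index i0 (s := ordlist M k)) ?mem_olist // e nth_index ?mem_olist.
  have /eqP := f3 _ (xA a) (x b) (etrans (gf a) (etrans (congr1 Some e') (esym (gf b)))).
  by rewrite nth_uniq ?(size_olist k pX) ?uniq_olist // => /eqP.
exists (perm rinj); apply/ffunP=> i; rewrite ffunE; case: ifP => [iA|/negbT/f1//].
have Li := index_olt pX iA.
have xi : x (Ordinal Li) = i by rewrite /x /= nth_index ?mem_olist.
rewrite -[index i _]/(val (Ordinal Li)) perm_natE permE /= nth_index ?mem_olist //.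
by rewrite -[in LHS]xi gf.
Qed.

Lemma pfun_value s (zt : 'I_n -> F) a : (a < lamc lam k)%N ->
  perm_arg s (tsub M zt k) a = zf (osub zt (pfun s)) (nth 0%N (ilist X k) a).
Proof.
move=> ak; rewrite /perm_arg insubT /tsub.
have ax : (a < size (ordlist X k))%N by rewrite (size_olist k pX).
case E : (ordlist X k) ax => [//|i0 l]; rewrite -E => ax.
rewrite [in RHS]ilistE [in RHS](nth_map i0) // zf_val /osub ffunE.
set i := nth i0 (ordlist X k) a.
have iA : i \in lev (color X) k by rewrite -mem_olist mem_nth.
rewrite iA index_uniq ?uniq_olist // ilistE /perm_nat insubT (nth_map i) ?zf_val //.
by rewrite (size_olist k pM) ltn_ord.
Qed.

End Biject.

Lemma symsum_wsum X M zt k y Y : is_part lam X -> is_part lam M ->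
  (forall c, (c < lamc lam k.+1)%N -> y c = zf Y (nth 0%N (ilist X k.+1) c)) ->
  symsum X (tsub M zt) k y = wsum h (lev (color X)) (lev (color M)) zt k Y.
Proof.
move=> pX pM; elim: k y Y => // k IH y Y ey; rewrite symsumS wsumS.
have -> : \sum_(f | injto (lev (color X) k.+1) (lev (color M) k.+1) f)
     ustep h (lev (color X) k.+1) (lev (color X) k.+2) (osub zt f) Y *
     wsum h (lev (color X)) (lev (color M)) zt k (osub zt f)
   = \sum_(f in [set pfun X M s | s in [set: 'S_(lamc lam k.+1)]])
     ustep h (lev (color X) k.+1) (lev (color X) k.+2) (osub zt f) Y *
     wsum h (lev (color X)) (lev (color M)) zt k (osub zt f).
  apply: eq_bigl => f; apply/idP/imsetP => [/pfun_surj[]// s ->|[s _ ->]].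
    by exists s.
  exact: pfun_injto.
rewrite big_imset /=; last by move=> s s' _ _; apply: pfun_inj.
apply: eq_big => [s|s _]; first by rewrite inE.
have pv a := @pfun_value X M k.+1 pX pM s zt a.
by rewrite (vstep_ustep pX pv ey) (IH _ _ pv).
Qed.

Hypothesis Hlam : (\sum_(j < N) lam j)%N = n.

Lemma lamcN : lamc lam N = n.
Proof. by rewrite -Hlam; apply: eq_bigl => j; rewrite ltn_ord. Qed.

Lemma W_wsum X M zt y : is_part lam X -> is_part lam M ->
  W lam X (tsub M zt) y h =
    (1 - h) ^+ lam1 lam * wsum h (lev (color X)) (lev (color M)) zt N.-1 y.
Proof.
move=> pX pM; rewrite /W; congr (_ * _).
(* For N = 0 the successor of N.-1 is not N; both sides then consist of empty products. *)
have [N0|N1] := posnP N.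
  have -> : N.-1 = 0%N by rewrite N0.
  by rewrite /= /U big_geq // N0.
rewrite (eq_symk _ _ (g := fun t' => \prod_(1 <= k < N.-1.+1)
    vstep X k (tt N t' y k) (tt N t' y k.+1))); last first.
  by move=> t'; rewrite UE prednK.
rewrite symk_symsum ?prednK //.
(* At level N every position occurs in the list, so rank and position coincide and t^(N) is y
   itself. *)
apply: symsum_wsum => // c cn; rewrite /tt prednK // in cn *; rewrite eqxx.
rewrite /ilist (eq_filter (a2 := predT)) => [|i]; last by rewrite /= ltn_ord.
by rewrite filter_predT val_enum_ord nth_iota -?lamcN.
Qed.

Lemma lam1E X : is_part lam X ->
  (1 - h) ^+ lam1 lam = \prod_(1 <= k < N) \prod_(i in lev (color X) k) (1 - h).
Proof.
move=> pX; rewrite /lam1 expr_sum; apply: eq_bigr => k _.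
by rewrite -(card_lev k pX) prodr_const.
Qed.

Lemma E_lev M zt : is_part lam M ->
  E lam (tsub M zt) h = \prod_(1 <= k < N) \prod_(i in lev (color M) k)
     \prod_(c in lev (color M) k) (1 - h * zt c / zt i).
Proof.
move=> pM; apply: eq_bigr => k _.
pose G i c := 1 - h * zf zt c / zf zt i.
pose H x := \prod_(0 <= b < lamc lam k) G x (nth 0%N (ilist M k) b).
transitivity (\prod_(0 <= a < lamc lam k) H (nth 0%N (ilist M k) a)) => //.
rewrite (big_ilist _ k xpredT H pM); apply: eq_big => [i|i _]; first by rewrite andbT.
rewrite /H (big_ilist _ k xpredT (G i) pM); apply: eq_big => [c|c _]; first by rewrite andbT.
by rewrite /G !zf_val.
Qed.

End Conversion.

(** * Inversions *)

Section Inversions.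
Local Open Scope nat_scope.

Lemma inversions_cons x s :
  inversions (x :: s) = \sum_(y <- s) (y < x) + inversions s.
Proof.
rewrite /inversions /= big_nat_recl //=; congr (_ + _).
  by rewrite big_add1 /= [RHS](big_nth 0).
by apply: eq_bigr => a _; rewrite big_add1.
Qed.

Lemma inversions_cat s1 s2 : inversions (s1 ++ s2) =
  inversions s1 + inversions s2 + \sum_(x <- s1) \sum_(y <- s2) (y < x).
Proof.
elim: s1 => [|x s1 IH] /=; first by rewrite big_nil addn0 [inversions [::]]big_geq.
by rewrite !inversions_cons IH big_cat big_cons /=; lia.
Qed.

Lemma inversions_sorted s : sorted ltn s -> inversions s = 0.
Proof.
elim: s => [|x s IH] /= srt; first by rewrite /inversions big_geq.
rewrite inversions_cons IH ?(path_sorted srt) // addn0 big1_seq // => y ys.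
move: srt; rewrite (path_sortedE ltn_trans) => /andP[/allP/(_ y ys)].
by rewrite /= ltnNge leq_eqVlt => /norP[_ /negPf->].
Qed.

Variables (N n : nat).
Implicit Type K : coloring N n.

Definition ninv K : nat := \sum_(i : 'I_n) \sum_(c : 'I_n) ((c < i) && (K c < K i)).

Let block K j := [seq val i | i <- enum 'I_n & K i == j].

Lemma big_blocks K (js : seq 'I_N) (g : nat -> nat) : uniq js ->
  \sum_(y <- flatten [seq block K j | j <- js]) g y = \sum_(c | K c \in js) g c.
Proof.
elim: js => [|j js IH] /=; first by rewrite big_nil big_pred0.
case/andP=> jjs ujs; rewrite big_cat /= IH // big_map big_filter big_enum_cond /=.
rewrite [RHS](bigID (fun c => K c == j)) /=; congr (_ + _); apply: eq_bigl => c.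
  by rewrite inE; case: eqP; rewrite ?andbF.
rewrite inE; case: eqP => [->|]; rewrite ?andbF ?andbT //=.
exact: negbTE.
Qed.

(** Each block is increasing, so inversions occur only between different blocks. Larger colors are
    listed first, hence a pair c < i is inverted exactly when K c < K i. *)
Lemma inversions_blocks K (js : seq 'I_N) : sorted (fun a b : 'I_N => b < a) js ->
  inversions (flatten [seq block K j | j <- js])
  = \sum_(i | K i \in js) \sum_(c | K c \in js) ((c < i) && (K c < K i)).
Proof.
have tr : transitive (fun a b : 'I_N => b < a) by move=> a b c ba cb; apply: ltn_trans cb ba.
have ir : irreflexive (fun a b : 'I_N => b < a) by move=> a; rewrite ltnn.
elim: js => [|j js IH] srt; first by rewrite /= [LHS]big_geq // big_pred0.
have [/allP ltj sjs] := andP (eq_ind _ is_true srt _ (path_sortedE tr j js)).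
have /andP[jjs ujs] : uniq (j :: js) := sorted_uniq tr ir srt.
rewrite /= inversions_cat inversions_sorted ?add0n; last first.
  apply: (subseq_sorted ltn_trans) (iota_ltn_sorted 0 n).
  by rewrite -val_enum_ord map_subseq // filter_subseq.
rewrite IH // [RHS](bigID (fun i => K i == j)) /= addnC; congr (_ + _).
  rewrite big_map big_filter big_enum_cond /=.
  apply: eq_big => [i|i /eqP Ki]; first by rewrite inE; case: eqP; rewrite ?andbF.
  rewrite big_blocks // [RHS](bigID (fun c => K c == j)) /= [X in _ = X + _]big1; last first.
    by move=> c /andP[_ /eqP->]; rewrite Ki ltnn andbF.
  rewrite add0n; apply: eq_big => [c|c Kc].
    rewrite inE; case: eqP => [->|]; rewrite ?andbF ?andbT //=.
    exact: negbTE.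
  by rewrite Ki ltj // andbT.
apply: eq_big => [i|i Ki].
  rewrite inE; case: eqP => [->|]; rewrite ?andbF ?andbT //=.
  exact: negbTE.
rewrite [RHS](bigID (fun c => K c == j)) /= [X in _ = X + _]big1; last first.
  by move=> c /andP[_ /eqP->]; rewrite [_ < K i]ltnNge (ltnW (ltj _ Ki)) andbF.
apply: eq_bigl => c; rewrite inE; case: eqP => [->|]; rewrite ?andbF ?andbT //=.
exact: negbTE.
Qed.

Lemma pinvE K : pinv K = ninv K.
Proof.
rewrite /pinv /seqK inversions_blocks; last first.
  rewrite rev_sorted; have := iota_ltn_sorted 0 N; rewrite -val_enum_ord sorted_map.
  by [].
apply: eq_big => [i|i _]; first by rewrite mem_rev mem_enum.
by apply: eq_bigl => c; rewrite mem_rev mem_enum.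
Qed.

(** A crude bound suffices: it makes [n * n - ninv J] a measure for the final induction. *)
Lemma ninv_le K : ninv K <= n * n.
Proof.
apply: (@leq_trans (\sum_(i < n) \sum_(c < n) 1)).
  by apply: leq_sum => i _; apply: leq_sum => c _; apply: leq_b1.
by rewrite !sum_nat_const card_ord muln1.
Qed.

(** The exchange matches the pairs for the two colorings and preserves all comparisons except that
    of p with q, a pair that counts only for K. *)
Lemma ninv_swap K (p q : 'I_n) : val q = (val p).+1 -> K p < K q ->
  ninv K = (ninv [ffun i => K (tperm p q i)]).+1.
Proof.
move=> pq Kpq; rewrite /ninv !pair_big /=.
rewrite [in RHS](reindex_inj (h := fun x : 'I_n * 'I_n => (tperm p q x.1, tperm p q x.2))) /=; last first.
  by move=> [i c] [i' c'] [] /perm_inj -> /perm_inj ->.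
rewrite (bigD1 (q, p)) //= [in RHS](bigD1 (q, p)) //= !ffunE !tpermK tpermL tpermR.
have plq : p < q by rewrite pq.
rewrite plq Kpq [q < p]ltnNge (ltnW plq) /= add0n add1n; congr _.+1.
apply: eq_bigr => -[i c] /= nx; rewrite !ffunE !tpermK.
have [/andP[/isadjP ai /isadjP ac]|na] := boolP (isadj p q i && isadj p q c); last first.
  by rewrite ltn_ss // andbC.
case: ai ac nx => -> [] ->; rewrite ?ltnn ?eqxx //.
by rewrite [K q < K p]ltnNge (ltnW Kpq) !andbF.
Qed.

End Inversions.

(** * The pairing *)

Section PermuteColoring.
Variables (N n : nat) (lam : 'I_N -> nat).
Implicit Types (K : coloring N n) (u : {perm 'I_n}).

Definition pcol u K : coloring N n := [ffun i => K (u i)].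

Lemma mem_lev_pcol u K k i : (i \in lev (color (pcol u K)) k) = (u i \in lev (color K) k).
Proof. by rewrite !inE /color ffunE. Qed.

Lemma pcol_id u K : involutive u -> pcol u (pcol u K) = K.
Proof. by move=> uK; apply/ffunP=> i; rewrite !ffunE uK. Qed.

Lemma is_part_pcol u K : is_part lam (pcol u K) = is_part lam K.
Proof.
apply: eq_forallb => j; congr (_ == _).
rewrite -[RHS](card_preimset _ (@perm_inj _ u)).
by congr #|pred_of_set _|; apply/setP=> i; rewrite !inE ffunE.
Qed.

Lemma prod_pcol (R : comPzRingType) u K (G : 'I_n -> 'I_n -> R) :
  \prod_a \prod_(b | (val (pcol u K a) < val (pcol u K b))%N) G (u a) (u b)
  = \prod_a \prod_(b | (val (K a) < val (K b))%N) G a b.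
Proof.
rewrite [RHS](reindex_inj (@perm_inj _ u)); apply: eq_bigr => a _.
rewrite [RHS](reindex_inj (@perm_inj _ u)); apply: eq_bigl => b.
by rewrite !ffunE.
Qed.

Lemma sorted_coloring K :
  (forall p q : 'I_n, val q = (val p).+1 -> (K p <= K q)%N) ->
  forall i c : 'I_n, (i <= c)%N -> (K i <= K c)%N.
Proof.
move=> adj i c; move: {2}(c - i)%N (erefl (c - i)%N) => d.
elim: d c => [|d IH] c e ic.
  by have -> : i = c by apply: val_inj => /=; lia.
have c' : (c.-1 < n)%N by have := ltn_ord c; lia.
apply: leq_trans (adj (Ordinal c') c _); last by rewrite /=; lia.
by apply: IH => /=; lia.
Qed.

End PermuteColoring.

Lemma tperm_conj (T : finType) (u : T -> T) (a b i : T) : involutive u ->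
  u (tperm (u a) (u b) i) = tperm a b (u i).
Proof.
move=> uK; case: tpermP => [->|->|ia ib]; rewrite ?uK ?tpermL ?tpermR //.
by rewrite tpermD //; apply/eqP=> e; [apply: ia | apply: ib]; rewrite e uK.
Qed.

Section Pairing.
Variables (F : fieldType) (N n : nat) (lam : 'I_N -> nat) (h : F).
Hypothesis h0 : h != 0.
Implicit Types (X I J K : coloring N n) (y z : 'I_n -> F) (u : {perm 'I_n}).

Definition admissible (g : F) z : Prop :=
  [/\ forall i, z i != 0, forall i j, i != j -> z i != z j &
      forall i j, g * z i != z j].

Lemma admissible_perm g z u : admissible g z -> admissible g (z \o u).
Proof.
case=> z0 zd hz; split=> //= i j ij; apply: zd.
by apply: contra ij => /eqP/perm_inj->.
Qed.

Lemma admissible_inv z : admissible h z -> admissible h^-1 (fun i => (z i)^-1).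
Proof.
case=> z0 zd hz; split=> [i|i j ij|i j]; first by rewrite invr_eq0.
  by apply: contra (zd _ _ ij) => /eqP/invr_inj->.
by rewrite -invfM; apply: contra (hz i j) => /eqP/invr_inj->.
Qed.

Definition weight (g : F) X I z y : F := wsum g (lev (color X)) (lev (color I)) z N.-1 y.

Lemma weight_target g u X I z y : weight g X (pcol u I) (z \o u) y = weight g X I z y.
Proof. by apply: wsum_target => j i; rewrite mem_lev_pcol. Qed.

Lemma eq_weight g X I z z' y y' : z =1 z' -> y =1 y' -> weight g X I z y = weight g X I z' y'.
Proof. exact: eq_wsum. Qed.

Section Adjacent.
Variables p q : 'I_n.
Hypothesis pq : val q = (val p).+1.
Let s := tperm p q.

Lemma weight_pcol g X I z y : weight g (pcol s X) I z y =
  wsum g (lev (color X \o s)) (lev (color I)) z N.-1 y.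
Proof. by apply: eq_wsum => // k; apply/setP=> i; rewrite !inE /color ffunE. Qed.

Lemma weight_exchange g X I z y : admissible g z ->
  (X p = X q -> weight g X I z (y \o s) = weight g X I z y) /\
  ((X p < X q)%N ->
    (y q - g * y p) * weight g X I z (y \o s)
      = (1 - g) * y p * weight g X I z y + (y q - y p) * weight g (pcol s X) I z y /\
    (y q - g * y p) * weight g (pcol s X) I z (y \o s)
      = (1 - g) * y q * weight g (pcol s X) I z y + g * (y q - y p) * weight g X I z y).
Proof.
case=> z0 zd hz.
have N1 : (0 < N)%N := leq_ltn_trans (leq0n _) (ltn_ord (X p)).
have [Heq Hlt] := wsum_exchange z0 zd hz pq (lev (color I)) (color X) N.-1.
rewrite prednK // in Heq Hlt.
split=> [e|lt]; first by apply: Heq; rewrite /color ?e // ltn_ord.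
by rewrite !weight_pcol; apply: Hlt => //; apply: ltn_ord.
Qed.

End Adjacent.

(* h ^ p(K) W_{sigma_0,K}(t^-1, y^-1, h^-1) at t = z_I, without the power of 1 - h. *)
Definition dual_weight K I z y : F :=
  h ^+ ninv K * weight h^-1 (pcol (sigma0 n) K) I (fun i => (z i)^-1)
                  (fun i => (y (sigma0 n i))^-1).

Lemma sigma0E (i : 'I_n) : sigma0 n i = rev_ord i.
Proof. by rewrite permE. Qed.

Lemma sigma0K : involutive (sigma0 n).
Proof. by move=> i; rewrite !sigma0E rev_ordK. Qed.

Lemma eq_dual_weight K I z z' y y' : z =1 z' -> y =1 y' -> dual_weight K I z y = dual_weight K I z' y'.
Proof. by move=> ez ey; congr (_ * _); apply: eq_weight => i; rewrite ?ez ?ey. Qed.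

Lemma dual_weight_target u K I z y : dual_weight K (pcol u I) (z \o u) y = dual_weight K I z y.
Proof. by congr (_ * _); apply: (weight_target _ u _ I (fun i => (z i)^-1)). Qed.

Section AdjacentDual.
Variables p q : 'I_n.
Hypothesis pq : val q = (val p).+1.
Let s := tperm p q.

(** The reversal turns p, q into the adjacent pair r q, r p in the opposite order. So
    [weight_exchange] is applied at h^-1 to the reversal of [pcol s K], whose colors increase along
    that pair. The power of h in the dual weight absorbs the one inversion by which K and [pcol s K]
    differ. *)
Lemma dual_weight_exchange K I z y : admissible h z -> (forall i, y i != 0) ->
  (K p = K q -> dual_weight K I z (y \o s) = dual_weight K I z y) /\
  ((K p < K q)%N ->
    (h * y q - y p) * dual_weight K I z (y \o s)
      = (h - 1) * y q * dual_weight K I z y + h * (y q - y p) * dual_weight (pcol s K) I z y /\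
    (h * y q - y p) * dual_weight (pcol s K) I z (y \o s)
      = (h - 1) * y p * dual_weight (pcol s K) I z y + (y q - y p) * dual_weight K I z y).
Proof.
move=> /admissible_inv az y0.
pose r := sigma0 n.
have rpq : val (r p) = (val (r q)).+1.
  by rewrite /r !sigma0E /=; have := ltn_ord q; move: pq => /=; lia.
have er (f : 'I_n -> F) : (fun i => ((f \o s) (r i))^-1)
    =1 (fun i => (f (r i))^-1) \o tperm (r q) (r p).
  by move=> i /=; rewrite /r (tperm_conj q p i sigma0K) [tperm q p]tpermC.
set y' := fun i => (y (r i))^-1.
have y'q : y' (r q) = (y q)^-1 by rewrite /y' sigma0K.
have y'p : y' (r p) = (y p)^-1 by rewrite /y' sigma0K.
have vs K' : dual_weight K' I z (y \o s) = h ^+ ninv K' * weight h^-1 (pcol r K') I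
    (fun i => (z i)^-1) (y' \o tperm (r q) (r p)).
  by congr (_ * _); apply: eq_weight.
have pr : pcol (tperm (r q) (r p)) (pcol r (pcol s K)) = pcol r K.
  apply/ffunP=> i; rewrite !ffunE /r (tperm_conj q p i sigma0K).
  by rewrite [tperm q p]tpermC tpermK.
split=> [e|lt]; rewrite !vs.
  congr (_ * _); apply: (weight_exchange rpq _ _ _ az).1.
  by rewrite !ffunE !sigma0K.
have ltX : (pcol r (pcol s K) (r q) < pcol r (pcol s K) (r p))%N.
  by rewrite !ffunE !sigma0K /s tpermL tpermR.
have [] := (weight_exchange rpq _ I y' az).2 ltX; rewrite pr y'q y'p.
rewrite /dual_weight -/r -/y' (ninv_swap pq lt) -/(pcol s K) exprS.
set m := h ^+ _; set a := weight _ _ _ _ _; set b := weight _ _ _ _ _.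
set a' := weight _ _ _ _ _; set b' := weight _ _ _ _ _ => e1 e2.
split.
(* The multiplier clears inverses: h y_q y_p (1/y_p - 1/(h y_q)) = h y_q - y_p. *)
- transitivity (m * h * (h * y q * y p) * (((y p)^-1 - h^-1 * (y q)^-1) * b')).
    by field; rewrite h0 !y0.
  by rewrite e2; field; rewrite h0 !y0.
- transitivity (m * (h * y q * y p) * (((y p)^-1 - h^-1 * (y q)^-1) * a)).
    by field; rewrite h0 !y0.
  by rewrite e1; field; rewrite h0 !y0.
Qed.

End AdjacentDual.

Definition level_E (g : F) I z : F := \prod_(1 <= k < N) \prod_(i in lev (color I) k)
     \prod_(c in lev (color I) k) (1 - g * z c / z i).

Lemma level_E_pcol g u I z : level_E g (pcol u I) (z \o u) = level_E g I z.
Proof.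
apply: eq_bigr => k _; rewrite [RHS](reindex_inj (@perm_inj _ u)).
apply: eq_big => [i|i _]; first by rewrite mem_lev_pcol.
rewrite [RHS](reindex_inj (@perm_inj _ u)).
by apply: eq_bigl => c; rewrite mem_lev_pcol.
Qed.

(** Everything in the summand at I that depends on neither J nor K. *)
Definition kappa I z : F :=
  Pf I z * ((1 - h) ^+ lam1 lam / level_E h I z)
   * ((1 - h^-1) ^+ lam1 lam / level_E h^-1 I (fun i => (z i)^-1))
   / (Rf I z * Qf I z h).

Lemma kappa_pcol u I z : kappa (pcol u I) (z \o u) = kappa I z.
Proof.
rewrite /kappa !level_E_pcol (level_E_pcol _ u I (fun i => (z i)^-1)).
have -> : Pf (pcol u I) (z \o u) = Pf I z.
  exact: (prod_pcol u I (fun a b => - (z b / z a))).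
have -> : Rf (pcol u I) (z \o u) = Rf I z.
  exact: (prod_pcol u I (fun a b => 1 - z b / z a)).
have -> // : Qf (pcol u I) (z \o u) h = Qf I z h.
exact: (prod_pcol u I (fun a b => 1 - h * z b / z a)).
Qed.

(** The outer arguments y1 and y2 are kept apart from z because the two exchange relations permute
    them independently; orthogonality concerns y1 = y2 = z. *)
Definition pairing J K z y1 y2 : F :=
  \sum_(I | is_part lam I) kappa I z * (weight h J I z y1 * dual_weight K I z y2).

(** The colorings I and [pcol u I] select the same values from z and from z o u, so the sum is only
    reindexed. *)
Lemma pairing_perm u J K z y1 y2 :
  pairing J K (z \o u) y1 y2 = pairing J K z y1 y2.
Proof.
rewrite /pairing (reindex_inj (h := pcol u)); last first.
  move=> I I' /ffunP e; apply/ffunP=> i.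
  by have := e (u^-1%g i); rewrite !ffunE permKV.
apply: eq_big => [I|I _]; first by rewrite is_part_pcol.
by rewrite kappa_pcol weight_target dual_weight_target.
Qed.

Lemma eq_pairing J K z y1 y2 y2' : y2 =1 y2' ->
  pairing J K z y1 y2 = pairing J K z y1 y2'.
Proof. by move=> ey; apply: eq_bigr => I _; rewrite (eq_dual_weight K I (frefl z) ey). Qed.

(** The mixed pairing of J' = [pcol s J] with K, where only the first outer argument is exchanged,
    is computed twice. The relation for J' expresses it by the pairings of J' and J with K; the
    relation for the dual weights expresses it by pairings of J' only, which are known. The known
    ones are needed at z o s too, hence the quantification over z'. *)
Lemma pairing_step J p q z :
  val q = (val p).+1 -> (J q < J p)%N -> admissible h z ->
  (forall K z', admissible h z' -> is_part lam K ->
     pairing (pcol (tperm p q) J) K z' z' z' = (pcol (tperm p q) J == K)%:R) ->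
  forall K, is_part lam K -> pairing J K z z z = (J == K)%:R.
Proof.
move=> pq Jqp az; set s := tperm p q; set J' := pcol s J => IH K pK.
have sK : involutive s := tpermK p q.
have J'J : pcol s J' = J by rewrite pcol_id.
have J'lt : (J' p < J' q)%N by rewrite !ffunE /s tpermL tpermR.
have [z0 zd hz] := az.
have yx : z q - z p != 0.
  rewrite subr_eq0 eq_sym; apply: zd; exact: adj_neq pq.
have d : z q - h * z p != 0 by rewrite subr_eq0 eq_sym.
pose S' := pairing J' K z (z \o s) z.
have e1 : (z q - h * z p) * S'
    = (1 - h) * z p * (J' == K)%:R + (z q - z p) * pairing J K z z z.
  rewrite -(IH K z az pK) /S' /pairing !mulr_sumr -big_split.
  apply: eq_bigr => I _ /=.
  have [+ _] := (weight_exchange pq J' I z az).2 J'lt; rewrite J'J -/s.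
  move=> e.
  transitivity (kappa I z * dual_weight K I z z * ((z q - h * z p) * weight h J' I z (z \o s))).
    by ring.
  by rewrite e; ring.
have az1 := admissible_perm s az.
(* Moving the exchange from the first outer argument to the second costs a change of base point from
   z to z o s. *)
have S'E : S' = pairing J' K (z \o s) (z \o s) ((z \o s) \o s).
  by rewrite pairing_perm; apply: eq_pairing => i /=; rewrite sK.
have z1p : (z \o s) p = z q by rewrite /= /s tpermL.
have z1q : (z \o s) q = z p by rewrite /= /s tpermR.
have z10 i : (z \o s) i != 0 by apply: z0.
have J'K : (J' == pcol s K) = (J == K).
  by apply/eqP/eqP => [e|<-//]; rewrite -J'J e pcol_id.
apply: (mulfI yx).
(* The dual relation is used for K or for [pcol s K], whichever has increasing colors at p, q. For
   equal colors the dual weight is symmetric, and neither J nor J' can be K. *)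
case: (ltngtP (K p) (K q)) => Kpq.
- have e2 : (h * z p - z q) * S' = (h - 1) * z p * (J' == K)%:R
      + h * (z p - z q) * (J' == pcol s K)%:R.
    rewrite -(IH K _ az1 pK) -(IH (pcol s K) _ az1) ?is_part_pcol // S'E /pairing.
    rewrite !mulr_sumr -big_split; apply: eq_bigr => I _ /=.
    have [+ _] := (dual_weight_exchange pq K I az1 z10).2 Kpq; rewrite z1p z1q -/s.
    move=> e; transitivity (kappa I (z \o s) * weight h J' I (z \o s) (z \o s)
      * ((h * z p - z q) * dual_weight K I (z \o s) ((z \o s) \o s))); first by ring.
    by rewrite e; ring.
  have JK : (J == K) = false.
    by apply/eqP=> e; move: Jqp; rewrite e ltnNge (ltnW Kpq).
  rewrite J'K JK mulr0 addr0 in e2; rewrite JK mulr0.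
  have {}e1 : (z q - z p) * pairing J K z z z
      = (z q - h * z p) * S' - (1 - h) * z p * (J' == K)%:R by rewrite e1; ring.
  have {}e2 : (z q - h * z p) * S' = (1 - h) * z p * (J' == K)%:R.
    by rewrite -opprB mulNr e2; ring.
  by rewrite e1 e2 subrr.
- have pK' : is_part lam (pcol s K) by rewrite is_part_pcol.
  have K'lt : (pcol s K p < pcol s K q)%N by rewrite !ffunE /s tpermL tpermR.
  have e2 : (h * z p - z q) * S' = (h - 1) * z q * (J' == K)%:R
      + (z p - z q) * (J' == pcol s K)%:R.
    rewrite -(IH K _ az1 pK) -(IH (pcol s K) _ az1) // S'E /pairing.
    rewrite !mulr_sumr -big_split; apply: eq_bigr => I _ /=.
    have [_] := (dual_weight_exchange pq (pcol s K) I az1 z10).2 K'lt.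
    rewrite z1p z1q -/s (pcol_id _ sK).
    move=> e; transitivity (kappa I (z \o s) * weight h J' I (z \o s) (z \o s)
      * ((h * z p - z q) * dual_weight K I (z \o s) ((z \o s) \o s))); first by ring.
    by rewrite e; ring.
  have JK : (J' == K) = false.
    by apply/eqP=> e; move: J'lt; rewrite e ltnNge (ltnW Kpq).
  rewrite J'K JK mulr0 add0r in e2; rewrite JK mulr0 add0r in e1.
  by rewrite -e1 -opprB mulNr e2; ring.
- have JK : (J == K) = false.
    by apply/eqP=> e; move: Jqp; rewrite e Kpq ltnn.
  have J'Kf : (J' == K) = false.
    by apply/eqP=> e; move: J'lt; rewrite e Kpq ltnn.
  have S0 : S' = 0.
    rewrite S'E -[RHS]/((false)%:R) -J'Kf -(IH K _ az1 pK); apply: eq_bigr => I _.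
    rewrite (dual_weight_exchange pq K I az1 z10).1 //.
    exact: val_inj.
  by rewrite S0 J'Kf !mulr0 add0r in e1; rewrite -e1 JK mulr0.
Qed.

End Pairing.

(** * Sorted colorings and the induction on inversions *)

Section BaseCase.
Variables (F : fieldType) (N n : nat) (lam : 'I_N -> nat).
Implicit Types (X I J K : coloring N n) (z : 'I_n -> F).

Lemma prod_pred m (G : nat -> F) :
  \prod_(1 <= j < m.-1.+1) G j = \prod_(1 <= j < m) G j.
Proof. by case: m => //; rewrite !big_geq. Qed.

(** The first alternative makes the level sets of X closed downwards, the second those of I closed
    upwards, as [wsum_triangular] asks. *)
Definition monotone_pair X I : Prop :=
  (forall i d : 'I_n, (d <= i)%N -> (X d <= X i)%N) \/
  (forall i d : 'I_n, (d <= i)%N -> (I i <= I d)%N).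

Lemma weight_prod g X I z : is_part lam X -> is_part lam I ->
  (forall i, z i != 0) -> monotone_pair X I ->
  weight g X I z z = \prod_(1 <= j < N)
    ((lev (color X) j == lev (color I) j)%:R
      * ustep g (lev (color X) j) (lev (color X) j.+1) z z).
Proof.
move=> pX pI z0 mon; rewrite -prod_pred; apply: wsum_triangular => //.
- exact: lev_mono.
- by move=> j; rewrite !(card_lev (lam := lam)).
- case: mon => mono; [left | right] => j i d; rewrite !inE /color => lj di;
    exact: leq_ltn_trans (mono _ _ di) lj.
- apply/setP=> i; rewrite !inE /color.
  by rewrite !(leq_trans (ltn_ord _) (leqSpred N)).
Qed.

Lemma weight_eq0 g X I z : is_part lam X -> is_part lam I ->
  (forall i, z i != 0) -> monotone_pair X I -> X != I -> weight g X I z z = 0.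
Proof.
move=> pX pI z0 mon XI; rewrite (weight_prod g pX pI z0 mon).
have [i ne] : exists i, X i != I i.
  apply/existsP; apply: contraR XI => /existsPn e.
  by apply/eqP/ffunP=> i; apply/eqP; have := e i; rewrite negbK.
apply/eqP; rewrite prodf_seq_eq0; apply/hasP.
have [lX lI] := (ltn_ord (X i), ltn_ord (I i)).
(* Just above the smaller of the two colors of i, exactly one of the two level sets contains i. This
   level is below N because the larger color is. *)
exists (minn (X i) (I i)).+1; first by rewrite mem_index_iota; move: ne; rewrite -val_eqE /=; lia.
rewrite /=; suff /negPf-> : lev (color X) (minn (X i) (I i)).+1 != lev (color I) (minn (X i) (I i)).+1.
  by rewrite mul0r.
apply/eqP=> /setP/(_ i); rewrite !inE /color; move: ne; rewrite -val_eqE /=; lia.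
Qed.

Lemma weight_diag g X z : is_part lam X -> admissible g z -> monotone_pair X X ->
  (1 - g) ^+ lam1 lam / level_E g X z * weight g X X z z
  = \prod_i \prod_(c | (X i < X c)%N) diagf g z i c.
Proof.
move=> pX [z0 zd hz] mon; rewrite (weight_prod g pX pX z0 mon) (lam1E g pX).
under [X in _ * X]eq_bigr => j _ do rewrite eqxx mul1r.
rewrite mulrAC -big_split /=.
under [X in X / _]eq_bigr => j _ do rewrite ustep_diag ?lev_mono //.
rewrite big_split /= -/(level_E g X z) mulrAC mulfV ?mul1r.
  by rewrite lev_diag // => i; apply: ltn_ord.
rewrite prodf_seq_neq0; apply/allP => k _ /=.
apply/prodf_neq0 => i _; apply/prodf_neq0 => c _.
rewrite subr_eq0 eq_sym; apply: contra (hz c i) => /eqP e.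
by rewrite -[z i]mul1r -e divfK.
Qed.

Variable h : F.
Hypothesis h0 : h != 0.

(** Since J increases, its weight leaves only I = J. Reversed, J decreases, so the dual weight at
    this point vanishes unless K = J. In the surviving term the weight yields R, and the dual weight
    together with P yields Q. *)
Lemma pairing_sorted J K z : is_part lam J -> is_part lam K -> admissible h z ->
  (forall i d : 'I_n, (d <= i)%N -> (J d <= J i)%N) ->
  pairing lam h J K z z z = (J == K)%:R.
Proof.
move=> pJ pK az Jsort; have [z0 zd hz] := az.
pose r := sigma0 n; pose z' := (fun i => (z i)^-1) \o r.
have az' : admissible h^-1 z'.
  exact: admissible_perm (admissible_inv az).
have rJ : forall i d : 'I_n, (d <= i)%N -> (pcol r J i <= pcol r J d)%N.
  by move=> i d di; rewrite !ffunE; apply: Jsort; rewrite /r !sigma0E /=; lia.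
have pr X : is_part lam X -> is_part lam (pcol r X) by rewrite is_part_pcol.
have [z0' _ _] := az'.
rewrite /pairing (bigD1 J) //= big1 ?addr0 => [|I /andP[pI nIJ]]; last first.
  by rewrite (weight_eq0 h pJ pI z0) ?mul0r ?mulr0 //; [left | rewrite eq_sym].
have -> : dual_weight h K J z z = h ^+ ninv K * weight h^-1 (pcol r K) (pcol r J) z' z'.
  by rewrite weight_target.
have [<-|nJK] := eqVneq J K; last first.
  rewrite (weight_eq0 h^-1 (pr _ pK) (pr _ pJ)) ?mulr0 //; first by right.
  apply: contra nJK => /eqP e; apply/eqP.
  by rewrite -(pcol_id J (@sigma0K n)) -(pcol_id K (@sigma0K n)) e.
rewrite /kappa -(level_E_pcol h^-1 r) -/z'.
have := weight_diag pJ az (or_introl Jsort).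
have := weight_diag (pr _ pJ) az' (or_intror rJ).
set a := _ / level_E h^-1 _ _; set b := _ / level_E h _ _.
set w' := weight _ _ _ _ _; set w := weight _ _ _ _ _ => e' e.
have lt i c : (J i < J c)%N -> (i < c)%N.
  by move=> Jic; rewrite ltnNge; apply/negP=> /Jsort; rewrite leqNgt Jic.
have eR : b * w = Rf J z.
  rewrite e; apply: eq_bigr => i _; apply: eq_bigr => c /lt ic.
  by rewrite /diagf ltnNge (ltnW ic).
(* Pair by pair this is h (-z_c/z_i) (1 - z_i/(h z_c)) = 1 - h z_c/z_i. As J increases, J i < J c
   implies i < c, so the exponent [ninv J] provides one h for every such pair. *)
have eQ : h ^+ ninv J * Pf J z * (a * w') = Qf J z h.
  have -> : a * w' = \prod_i \prod_(c | (J i < J c)%N) (1 - h^-1 * (z c)^-1 / (z i)^-1).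
    rewrite e' -(prod_pcol r J (fun i c => 1 - h^-1 * (z c)^-1 / (z i)^-1)).
    apply: eq_bigr => i _; apply: eq_bigr => c; rewrite !ffunE => /lt.
    rewrite /r !sigma0E /diagf /= => ic.
    by rewrite -!sigma0E ifT //; have := ltn_ord i; have := ltn_ord c; lia.
  have -> : h ^+ ninv J = \prod_i \prod_(c | (J i < J c)%N) h.
    rewrite /ninv exchange_big /= expr_sum; apply: eq_bigr => i _.
    rewrite expr_sum [RHS]big_mkcond; apply: eq_bigr => c _ /=.
    case: (ltnP (J i) (J c)) => [Jic|_]; last by rewrite andbF.
    by rewrite (lt _ _ Jic).
  rewrite -!big_split; apply: eq_bigr => i _; rewrite -!big_split.
  by apply: eq_bigr => c _ /=; field; rewrite h0 !z0 oner_neq0.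
have R0 : Rf J z != 0.
  apply/prodf_neq0 => i _; apply/prodf_neq0 => c /lt ic.
  have ci : c != i by rewrite -val_eqE /= gtn_eqF.
  rewrite subr_eq0 eq_sym; apply: contra (zd _ _ ci) => /eqP E.
  by rewrite -[z i]mul1r -E divfK.
have Q0 : Qf J z h != 0.
  apply/prodf_neq0 => i _; apply/prodf_neq0 => c _.
  rewrite subr_eq0 eq_sym; apply: contra (hz c i) => /eqP E.
  by rewrite -[z i]mul1r -E divfK.
transitivity ((b * w) * (h ^+ ninv J * Pf J z * (a * w')) / (Rf J z * Qf J z h)).
  by ring.
by rewrite eR eQ divff // mulf_neq0.
Qed.

(** Exchanging a descent of J raises [ninv] by one, so the process ends at a J without descents,
    which is weakly increasing. *)
Lemma pairing_orthogonal J K z : is_part lam J -> is_part lam K -> admissible h z ->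
  pairing lam h J K z z z = (J == K)%:R.
Proof.
elim: {J}(n * n - ninv J)%N {-2}J (leqnn (n * n - ninv J)) K z => [|m IH] J le K z pJ pK az.
(* Both induction cases look for a descent. In the base case [ninv J] has reached its bound n * n,
   so a descent would push it beyond. *)
all: have [/existsP[p /existsP[q /andP[/eqP pq Jqp]]]|nodesc] :=
  boolP [exists p, exists q, (val q == (val p).+1) && (J q < J p)%N].
all: try by apply: pairing_sorted => // i d di; apply: (sorted_coloring _ di) => p q pq;
  move: nodesc => /existsPn/(_ p)/existsPn/(_ q); rewrite pq eqxx /= -leqNgt.
all: have lt' : (pcol (tperm p q) J p < pcol (tperm p q) J q)%N
  by rewrite !ffunE tpermL tpermR.
all: have := ninv_swap pq lt'; rewrite -/(pcol _ _) pcol_id ?tpermK; last exact: tpermK.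
all: have := ninv_le (pcol (tperm p q) J) => le1 e.
  by lia.
apply: (pairing_step h0 pq Jqp az) => // K' z' az' pK'; apply: IH => //.
  by lia.
by rewrite is_part_pcol.
Qed.

End BaseCase.

Theorem theorem6p6 (F : fieldType) (N n : nat) (lam : 'I_N -> nat)
  (Hlam : (\sum_(j < N) lam j)%N = n)
  (z : 'I_n -> F) (h : F)
  (Hz0 : forall i, z i != 0)
  (Hzd : forall i j, i != j -> z i != z j)
  (Hh0 : h != 0)
  (Hhz : forall i j, h * z i != z j)
  (J K : {ffun 'I_n -> 'I_N})
  (HJ : is_part lam J) (HK : is_part lam K) :
  \sum_(I : {ffun 'I_n -> 'I_N} | is_part lam I)
     h ^+ pinv K * Pf I z
     * (Wt lam 1 J I z h * Wt lam (sigma0 n) K I (fun i => (z i)^-1) h^-1)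
     / (Rf I z * Qf I z h)
  = (J == K)%:R.
Proof.
rewrite -(pairing_orthogonal Hh0 HJ HK (And3 Hz0 Hzd Hhz)).
apply: eq_bigr => I pI; rewrite /Wt /Wsig -!/(pcol _ _) !W_wsum ?is_part_pcol //.
rewrite !E_lev // -!/(level_E _ _ _) pinvE.
have -> : pcol 1%g J = J by apply/ffunP=> i; rewrite ffunE perm1.
rewrite -!/(weight _ _ _ _ _) (@eq_weight _ _ _ h J I z z _ z) // => [|i]; last by rewrite perm1.
rewrite /kappa /dual_weight.
by ring.
Qed.
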